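(* If $\sup R < \infty$ and $M$ is locally finite in $\mathsf{D}^-(R)$ with $\operatorname{amp} M \leq \sup R$, then the Bass numbers of $M$ can have no gaps of length bigger than or equal to $\sup R$. In particular, if $\sup R < \infty$, the Bass numbers of $R$ itself can have no gaps of length bigger than or equal to $\sup R$.
   Context: $k$ is a field and $R$ is a cochain Differential Graded (DG) algebra over $k$ (cohomologically graded) of the form $\cdots \to 0 \to k \to 0 \to R^2 \to R^3 \to \cdots$, i.e. $R^j = 0$ for $j<0$, $R^0 = k$, $R^1 = 0$, with $\dim_k \mathrm{H}^j(R) < \infty$ for each $j$. $\mathsf{D}(R)$ is the derived category of DG left-$R$-modules, and $\mathsf{D}^-(R)$ is its full subcategory of those $M$ with $\mathrm{H}^j(M) = 0$ for $j \gg 0$. $k$ is viewed as a DG bi-$R$-module concentrated in degree $0$. A DG $R$-module $N$ is locally finite if $\dim_k \mathrm{H}^j(N) < \infty$ for each $j$. For a DG module $N$: $\inf N = \inf\{ j \mid \mathrm{H}^j(N) \neq 0\}$, $\sup N = \sup\{ j \mid \mathrm{H}^j(N)\neq 0\}$, $\operatorname{amp} N = \sup N - \inf N$, with the conventions $\inf \varnothing = \infty$, $\sup\varnothing = -\infty$. The Bass numbers of a DG left-$R$-module $M$ are $\mu^j(M) = \dim_k \mathrm{H}^j(\mathrm{RHom}_R(k,M))$. The Bass numbers of $M$ have a gap of length $g$ (an integer) if there is an integer $j$ such that $\mu^j(M) \neq 0$, $\mu^{\ell}(M) = 0$ for $j+1 \leq \ell \leq j+g$, and $\mu^{j+g+1}(M)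 \neq 0$. *)

(* Defs.v *)
From HB Require Import structures.
From mathcomp Require Import all_boot all_order all_algebra.
From mathcomp Require Import boolp classical_sets functions.
From mathcomp Require Import constructive_ereal.

Set Implicit Arguments.
Unset Strict Implicit.
Unset Printing Implicit Defensive.

Import Order.TTheory GRing.Theory Num.Theory.

Local Open Scope classical_set_scope.
Local Open Scope ring_scope.

(* A complex of k-vector spaces ... -> V^i -> V^(i+1) -> ... is represented by
   its total space V = \bigoplus_i V^i, the projections of V onto the summands
   V^i, and the differential as an endomorphism of V. This keeps products of
   homogeneous elements free of transports along equations between degrees. *)
Record dgStruct (k : fieldType) (V : lmodType k) := DgStruct {
  dproj : int -> V -> V;
  diff : V -> V;
  dproj_linear : forall i, linear (dproj i);
  dprojE : forall i j x, dproj i (dproj j x) = if i == j then dproj j x else 0;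
  dproj_sum : forall x,
    exists2 s : seq int, uniq s & x = \sum_(i <- s) dproj i x;
  diff_linear : linear diff;
  diff_deg : forall i x, dproj i x = x -> dproj (i + 1) (diff x) = diff x;
  diffK : forall x, diff (diff x) = 0
}.

HB.instance Definition _ (k : fieldType) (V : lmodType k) (D : dgStruct V) i :=
  GRing.isLinear.Build k V V _ (dproj D i) (dproj_linear D i).
HB.instance Definition _ (k : fieldType) (V : lmodType k) (D : dgStruct V) :=
  GRing.isLinear.Build k V V _ (diff D) (diff_linear D).

(* [gr D i] is the summand V^i. *)
Definition gr (k : fieldType) (V : lmodType k) (D : dgStruct V) (i : int) :
  set V := [set x | dproj D i x = x].

Definition ksign (k : fieldType) (i : int) : k := (-1) ^ i.

Section Cohomology.
Variables (k : fieldType) (V : lmodType k).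

(* [e] is a basis of the subquotient (Z + B) / B of V. *)
Definition subquo_basis (Z B : set V) (n : nat) (e : 'I_n -> V) : Prop :=
  [/\ forall i, Z (e i),
      forall c : 'I_n -> k, B (\sum_i c i *: e i) -> forall i, c i = 0 &
      forall z, Z z -> exists c : 'I_n -> k, B (z - \sum_i c i *: e i)].

(* The dimension of Z / B, with value +oo when it has no finite basis. *)
Definition subquo_dim (Z B : set V) : \bar int :=
  xget +oo%E [set d | exists n (e : 'I_n -> V),
                        subquo_basis Z B e /\ d = (Posz n)%:E%E].

Variable D : dgStruct V.

Definition cocycles (j : int) : set V := [set x | gr D j x /\ diff D x = 0].
Definition cobounds (j : int) : set V := diff D @` gr D (j - 1).

Definition coh_dim (j : int) : \bar int :=
  subquo_dim (cocycles j) (cobounds j).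

Definition coh_zero (j : int) : Prop := cocycles j `<=` cobounds j.

Definition dg_sup : \bar int :=
  supremum -oo%E [set j%:E%E | j in [set j | ~ coh_zero j]].
Definition dg_inf : \bar int :=
  infimum +oo%E [set j%:E%E | j in [set j | ~ coh_zero j]].

(* For an acyclic complex this is -oo - +oo = -oo. *)
Definition dg_amp : \bar int := (dg_sup - dg_inf)%E.

Definition locally_finite : Prop := forall j, (coh_dim j < +oo)%E.
Definition coh_bounded_above : Prop :=
  exists n : int, forall j, n < j -> coh_zero j.
Definition acyclic : Prop := forall j, coh_zero j.

End Cohomology.

Record dgAlg (k : fieldType) := DgAlg {
  dga_sort :> algType k;
  dga_dg : dgStruct dga_sort;
  dga_one : gr dga_dg 0 1;
  dga_mul : forall i j x y,
    gr dga_dg i x -> gr dga_dg j y -> gr dga_dg (i + j) (x * y);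
  dga_leibniz : forall i x y, gr dga_dg i x ->
    diff dga_dg (x * y) = diff dga_dg x * y + ksign k i *: (x * diff dga_dg y)
}.

(* DG left-R-modules. *)
Record dgMod (k : fieldType) (R : dgAlg k) := DgMod {
  dgm_sort :> lmodType k;
  dgm_dg : dgStruct dgm_sort;
  act : R -> dgm_sort -> dgm_sort;
  act_linearl : forall x, linear (act^~ x);
  act_linearr : forall r, linear (act r);
  actA : forall r s x, act r (act s x) = act (r * s) x;
  act1 : forall x, act 1 x = x;
  act_deg : forall i j r x,
    gr (dga_dg R) i r -> gr dgm_dg j x -> gr dgm_dg (i + j) (act r x);
  act_leibniz : forall i r x, gr (dga_dg R) i r ->
    diff dgm_dg (act r x)
    = act (diff (dga_dg R) r) x + ksign k i *: act r (diff dgm_dg x)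
}.

Section RegularModule.
Variables (k : fieldType) (R : dgAlg k).

Let mul_linearl (x : R) : linear ( *%R^~ x : R -> R).
Proof. by move=> a r s; rewrite mulrDl scalerAl. Qed.
Let mul_linearr (r : R) : linear ( *%R r : R -> R).
Proof. by move=> a x y; rewrite mulrDr scalerAr. Qed.

Definition dgm_reg : dgMod R :=
  @DgMod k R R (dga_dg R) *%R mul_linearl mul_linearr
    (@mulrA R) (@mul1r R) (@dga_mul k R) (@dga_leibniz k R).

End RegularModule.

(* R is of the form ... -> 0 -> k -> 0 -> R^2 -> R^3 -> ... *)
Record simply_connected (k : fieldType) (R : dgAlg k) : Prop := {
  sc_neg : forall i x, i < 0 -> gr (dga_dg R) i x -> x = 0;
  sc_zero : forall x, gr (dga_dg R) 0 x -> exists c : k, x = c%:A;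
  sc_one : forall x, gr (dga_dg R) 1 x -> x = 0
}.

(* k as a DG left-R-module concentrated in degree 0, on which r acts as its
   component [aug r] in R^0 = k. *)
Section ResidueModule.
Variables (k : fieldType) (R : dgAlg k).

Definition aug (r : R) : k := xget 0 [set c | dproj (dga_dg R) 0 r = c%:A].

Let proj_k (i : int) (x : k^o) : k^o := if i == 0 then x else 0.

Let proj_k_linear i : linear (proj_k i).
Proof.
by move=> a x y; rewrite /proj_k; case: eqP => // _; rewrite scaler0 addr0.
Qed.

Let proj_kE i j x : proj_k i (proj_k j x) = if i == j then proj_k j x else 0.
Proof.
rewrite /proj_k; case: (eqVneq j 0) => [->|_]; last by rewrite !if_same.
by case: (i == 0).
Qed.

Let proj_k_sum x : exists2 s : seq int, uniq s & x = \sum_(i <- s) proj_k i x.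
Proof. by exists [:: 0]; rewrite // big_seq1 /proj_k eqxx. Qed.

Let diff_k (x : k^o) : k^o := 0.

Let diff_k_linear : linear diff_k.
Proof. by move=> a x y; rewrite /diff_k scaler0 addr0. Qed.

Let diff_k_deg i x : proj_k i x = x -> proj_k (i + 1) (diff_k x) = diff_k x.
Proof. by rewrite /proj_k if_same. Qed.

Let diff_kK x : diff_k (diff_k x) = 0. Proof. by []. Qed.

Definition residue_dg : dgStruct k^o :=
  DgStruct proj_k_linear proj_kE proj_k_sum diff_k_linear diff_k_deg diff_kK.

Hypothesis scR : simply_connected R.

Let pr := dproj (dga_dg R).

Let gr_pr i x : gr (dga_dg R) i (pr i x).
Proof. by rewrite /gr /= dprojE eqxx. Qed.

Let pr_ne i j x : i != j -> gr (dga_dg R) j x -> pr i x = 0.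
Proof. by move=> /negbTE ij <-; rewrite /pr dprojE ij. Qed.

Let natA_inj (a b : k) : a%:A = b%:A :> R -> a = b.
Proof.
move=> ab; apply/eqP; rewrite -subr_eq0; apply: contraT => nz.
have : (a - b) *: (1 : R) = 0 by rewrite scalerBl ab subrr.
move/(congr1 (fun x => (a - b)^-1 *: x)); rewrite scalerA mulVf // scale1r.
by rewrite scaler0 => /eqP; rewrite oner_eq0.
Qed.

Lemma augE (r : R) : dproj (dga_dg R) 0 r = (aug r)%:A.
Proof.
have [c cE] := sc_zero scR (gr_pr 0 r).
by apply: (@xgetI _ 0 [set c | dproj (dga_dg R) 0 r = c%:A] c).
Qed.

Lemma aug_unique (r : R) c : dproj (dga_dg R) 0 r = c%:A -> aug r = c.
Proof. by rewrite augE => /natA_inj. Qed.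

Let aug0 (r : R) : pr 0 r = 0 -> aug r = 0.
Proof. by move=> r0; apply: aug_unique; rewrite scale0r. Qed.

Let aug_linear a (r s : R) : aug (a *: r + s) = a * aug r + aug s.
Proof.
by apply: aug_unique; rewrite linearP /= !augE scalerDl scalerA.
Qed.

Lemma augM (r s : R) : aug (r * s) = aug r * aug s.
Proof.
apply: aug_unique.
have dec (x : R) : x = pr 0 x + (x - pr 0 x) by rewrite addrC subrK.
have prM (x y : R) i j : gr (dga_dg R) i x -> gr (dga_dg R) j y ->
    pr 0 (x * y) = pr 0 x * pr 0 y.
  move=> xi yj; have xyij := dga_mul xi yj.
  have [i0|i0|i0] := ltgtP i 0.
  - by rewrite (sc_neg scR i0 xi) /pr mul0r linear0 mul0r.
  - have [j0|j0] := ltP j 0.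
      by rewrite (sc_neg scR j0 yj) /pr mulr0 linear0 mulr0.
    by rewrite (pr_ne _ xyij) ?(pr_ne _ xi) ?mul0r // lt_eqF // ltr_wpDr.
  - move: xi xyij; rewrite i0 add0r => xi xyij.
    have [j0|j0] := eqVneq j 0.
      by move: yj xyij; rewrite j0 /gr /= /pr xi => -> ->.
    by rewrite (pr_ne _ xyij) ?(pr_ne _ yj) ?mulr0 // eq_sym.
have [sr _ rE] := dproj_sum (dga_dg R) r.
have [ss _ sE] := dproj_sum (dga_dg R) s.
rewrite -scalerA -[aug s *: 1]mul1r scalerAl -!augE.
rewrite {1}rE {1}sE big_distrlr linear_sum /=.
rewrite [in RHS]rE [in RHS]sE !linear_sum big_distrlr /=.
apply: eq_bigr => i _; rewrite linear_sum; apply: eq_bigr => j _.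
exact: (prM _ _ i j (gr_pr i r) (gr_pr j s)).
Qed.

Let act_k (r : R) (x : k^o) : k^o := aug r * x.

Let act_k_linearl x : linear (act_k^~ x).
Proof. by move=> a r s; rewrite /act_k aug_linear mulrDl -mulrA. Qed.

Let act_k_linearr r : linear (act_k r).
Proof.
by move=> a x y; rewrite /act_k mulrDr; congr (_ + _); apply: mulrCA.
Qed.

Let act_kA r s x : act_k r (act_k s x) = act_k (r * s) x.
Proof. by rewrite /act_k augM mulrA. Qed.

Let act_k1 x : act_k 1 x = x.
Proof.
rewrite /act_k (@aug_unique 1 1) ?mul1r // scale1r; exact: dga_one.
Qed.

Let act_k_deg i j r x : gr (dga_dg R) i r -> gr residue_dg j x ->
  gr residue_dg (i + j) (act_k r x).
Proof.
move=> ri; have [->|i0] := eqVneq i 0.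
  rewrite add0r /gr /= /proj_k; case: eqP => // _ <-.
  by rewrite /act_k mulr0.
by move=> _; rewrite /gr /= /proj_k /act_k aug0 ?mul0r ?if_same //
  (pr_ne _ ri) // eq_sym.
Qed.

Let act_k_leibniz i r x : gr (dga_dg R) i r ->
  diff residue_dg (act_k r x)
  = act_k (diff (dga_dg R) r) x + ksign k i *: act_k r (diff residue_dg x).
Proof.
move=> ri; rewrite /= /diff_k /act_k mulr0 scaler0 addr0 aug0 ?mul0r //.
have [i1|i1] := eqVneq (i + 1) 0.
  have i0 : i < 0 by move/eqP: i1; rewrite addr_eq0 => /eqP ->.
  by rewrite (sc_neg scR i0 ri) linear0 /pr linear0.
by apply: (@pr_ne _ (i + 1)); rewrite 1?eq_sym //; exact: diff_deg.
Qed.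

Definition residue : dgMod R :=
  DgMod act_k_linearl act_k_linearr act_kA act_k1 act_k_deg act_k_leibniz.

End ResidueModule.

Section HomComplex.
Variables (k : fieldType) (R : dgAlg k).

(* Hom_R(P, M)^n, with the Koszul sign in the R-linearity. *)
Definition dghom (P M : dgMod R) (n : int) : set (P -> M) :=
  [set f | [/\ linear f,
     forall i x, gr (dgm_dg P) i x -> gr (dgm_dg M) (i + n) (f x) &
     forall i r x, gr (dga_dg R) i r ->
       f (act r x) = ksign k (n * i) *: act r (f x)]].

Definition dghom_diff (P M : dgMod R) (n : int) (f : P -> M) : P -> M :=
  fun x => diff (dgm_dg M) (f x) - ksign k n *: f (diff (dgm_dg P) x).

Definition dghom_cocycles (P M : dgMod R) (n : int) : set (P -> M) :=
  [set f | dghom n f /\ forall x, dghom_diff n f x = 0].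

Definition dghom_cobounds (P M : dgMod R) (n : int) : set (P -> M) :=
  dghom_diff (n - 1) @` @dghom P M (n - 1).

Definition K_projective (P : dgMod R) : Prop :=
  forall N : dgMod R, acyclic (dgm_dg N) ->
  forall n, @dghom_cocycles P N n `<=` @dghom_cobounds P N n.

(* Degree 0 cocycles of Hom_R(P, N) are the morphisms of DG modules. *)
Record quasi_iso (P N : dgMod R) (f : P -> N) : Prop := {
  qi_morph : dghom_cocycles 0 f;
  qi_inj : forall j x, cocycles (dgm_dg P) j x ->
    cobounds (dgm_dg N) j (f x) -> cobounds (dgm_dg P) j x;
  qi_surj : forall j y, cocycles (dgm_dg N) j y ->
    exists2 x, cocycles (dgm_dg P) j x & cobounds (dgm_dg N) j (f x - y)
}.

Record K_projective_resolution (N : dgMod R) := {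
  res_sort :> dgMod R;
  res_map : res_sort -> N;
  res_K_projective : K_projective res_sort;
  res_quasi_iso : quasi_iso res_map
}.

(* dim_k H^j(RHom_R(N, M)), where RHom_R(N, M) is computed as Hom_R(P, M)
   for a K-projective resolution P of N. *)
Definition ext_dim (N : dgMod R) (P : K_projective_resolution N) (M : dgMod R)
    (j : int) : \bar int :=
  subquo_dim (@dghom_cocycles P M j) (@dghom_cobounds P M j).

End HomComplex.

Definition bass (k : fieldType) (R : dgAlg k) (scR : simply_connected R)
    (P : K_projective_resolution (residue scR)) (M : dgMod R) (j : int) :
  \bar int := ext_dim P M j.

Definition has_gap (mu : int -> \bar int) (g : int) : Prop :=
  exists j : int, [/\ mu j <> 0%E,
    forall l : int, j + 1 <= l <= j + g -> mu l = 0%E &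
    mu (j + g + 1) <> 0%E].

(* Main.v *)
Require Import Defs.
From HB Require Import structures.
From mathcomp Require Import all_boot all_order all_algebra.
From mathcomp Require Import boolp classical_sets functions.
From mathcomp Require Import constructive_ereal.
From mathcomp Require Import zify ring.

Import Order.TTheory GRing.Theory Num.Theory.
Local Open Scope ring_scope.

(** Let d = sup R and suppose that the Bass numbers of M are nonzero in degrees
    j and j + g + 1 and zero in between, where g >= d. Two facts contradict
    the bound on the amplitude of M: the cohomology of M is nonzero in some
    degree >= j + g + 1 ([contractible_hom_above]), and it is nonzero in degree
    j ([contractible_hom_gap]). So amp M > g >= sup R. For M = R the second
    fact gives j >= 0, and the first a degree above sup R with cohomology.

    Write P for a K-projective resolution of the residue field. The first fact
    is an orthogonality: a morphism X -> M of degree n is homotopic to 0 when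
    X is K-projective with cohomology in degrees >= s and M has cohomology in
    degrees < s + n ([contractible_hom_orthogonal]). Indeed X may be replaced
    by a submodule that starts in degree s, the morphism then takes its values
    in a submodule of M starting in degree s + n, and this submodule becomes
    acyclic when a complement of the cocycles is added in the degree below.
    Both truncations are submodules because R is k in degree 0 and vanishes in
    negative degrees, and the complements exist by Zorn.

    For the second fact, suppose that H^j(M) = 0 and let f : P -> M be a
    cocycle of degree j. Choose a cocycle p0 of P over 1 in k, and let X be the
    cone of the map R -> P given by p0. As f p0 is a coboundary, f extends to
    X. The cohomology of X is that of R in degrees >= 2, moved down by one, so
    it is finite-dimensional in each degree and lives in degrees 1, ..., d - 1.
    Its classes can be killed from the top, one at a time, by cones of maps
    P -> Q of degree b, where b is the top degree of the cohomology of the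
    module Q reached so far. Such a map through a given class exists by
    orthogonality ([generator_lift]), and the morphism to M extends over the
    new cone since Ext^(j + b)(k, M) is 0 for 1 <= b <= d
    ([pcobound_through_finite]). In the end f factors through an acyclic
    module, hence is homotopic to 0 as P is K-projective, and the Bass number
    of M in degree j is 0. *)
Set Implicit Arguments.
Unset Strict Implicit.
Unset Printing Implicit Defensive.

(** * Graded vector spaces *)

Section GradedSpaces.
Variables (k : fieldType) (V : lmodType k) (D : dgStruct V).
Implicit Types (x y : V) (i j : int).

Lemma gr_dproj i x : gr D i (dproj D i x).
Proof. by rewrite /gr /= dprojE eqxx. Qed.

Lemma dproj_gr_ne i j x : gr D j x -> i != j -> dproj D i x = 0.
Proof. by move=> <- /negbTE ij; rewrite dprojE ij. Qed.

Lemma gr0 i : gr D i 0. Proof. exact: linear0. Qed.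

Lemma grP i a x y : gr D i x -> gr D i y -> gr D i (a *: x + y).
Proof. by move=> xi yi; rewrite /gr /= linearP /= xi yi. Qed.

Lemma grZ i a x : gr D i x -> gr D i (a *: x).
Proof. by move=> xi; rewrite -[a *: x]addr0; apply: grP => //; apply: gr0. Qed.

Lemma grD i x y : gr D i x -> gr D i y -> gr D i (x + y).
Proof. by move=> xi; rewrite -[x]scale1r; apply: grP. Qed.

Lemma grN i x : gr D i x -> gr D i (- x).
Proof. by rewrite -scaleN1r; apply: grZ. Qed.

Lemma grB i x y : gr D i x -> gr D i y -> gr D i (x - y).
Proof. by move=> xi yi; apply: grD => //; apply: grN. Qed.

Lemma gr_diff i j x : j = i + 1 -> gr D i x -> gr D j (diff D x).
Proof. by move=> ->; apply: diff_deg. Qed.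

Lemma gr_diffB i x : gr D (i - 1) x -> gr D i (diff D x).
Proof. by apply: gr_diff; rewrite subrK. Qed.

Lemma dproj_eq0 x : (forall i, dproj D i x = 0) -> x = 0.
Proof.
move=> x0; have [s _ ->] := dproj_sum D x.
by rewrite big1 // => i _; apply: x0.
Qed.

Lemma dproj_inj x y : (forall i, dproj D i x = dproj D i y) -> x = y.
Proof.
move=> xy; apply/eqP; rewrite -subr_eq0; apply/eqP/dproj_eq0 => i.
by rewrite linearB /= xy subrr.
Qed.

Lemma dproj_supp x :
  exists2 s : seq int, uniq s & forall i, i \notin s -> dproj D i x = 0.
Proof.
have [s us xE] := dproj_sum D x; exists s => // i si.
rewrite xE linear_sum big_seq big1 // => j sj.
by rewrite /= dprojE; case: eqP => // ij; rewrite ij sj in si.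
Qed.

Lemma dproj_sumE i (s : seq int) (c : int -> k) x : uniq s ->
  dproj D i (\sum_(j <- s) c j *: dproj D j x)
    = if i \in s then c i *: dproj D i x else 0.
Proof.
move=> us; rewrite linear_sum; case: ifP => si; last first.
  rewrite big_seq big1 // => j sj; rewrite linearZ /= dprojE.
  by case: eqP => [ij|_]; [rewrite ij sj in si | rewrite scaler0].
rewrite (bigD1_seq i) //= linearZ /= dprojE eqxx big1 ?addr0 // => j ji.
by rewrite linearZ /= dprojE eq_sym (negbTE ji) scaler0.
Qed.

Lemma dproj_suppE (s : seq int) x : uniq s ->
  (forall i, i \notin s -> dproj D i x = 0) -> x = \sum_(i <- s) dproj D i x.
Proof.
move=> us xs; apply: dproj_inj => i.
under eq_bigr => j _ do rewrite -[dproj D j x]scale1r.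
by rewrite (dproj_sumE i (fun=> 1)) // scale1r; case: ifPn => // /xs.
Qed.

Lemma gr_ind (Q : V -> Prop) :
  Q 0 -> (forall x y, Q x -> Q y -> Q (x + y)) ->
  (forall i x, gr D i x -> Q x) -> forall x, Q x.
Proof.
move=> Q0 QD Qg x; have [s _ ->] := dproj_sum D x.
by apply: big_ind => // i _; apply: Qg (gr_dproj i x).
Qed.

Lemma dproj_diff i x : dproj D i (diff D x) = diff D (dproj D (i - 1) x).
Proof.
move: x; apply: gr_ind => [|x y|j x xj]; first by rewrite !linear0.
  by rewrite !linearD /= => -> ->.
have [ji|ij] := eqVneq j (i - 1).
  by rewrite -ji xj; apply: gr_diffB; rewrite -ji.
rewrite (dproj_gr_ne xj) 1?eq_sym // linear0.
apply: (dproj_gr_ne (gr_diff (erefl _) xj)).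
by apply: contra ij => /eqP ->; rewrite addrK.
Qed.

Lemma cocycles0 i : cocycles D i 0.
Proof. by split; [exact: gr0 | exact: linear0]. Qed.

Lemma cocyclesP i a x y :
  cocycles D i x -> cocycles D i y -> cocycles D i (a *: x + y).
Proof.
move=> [xi dx] [yi dy]; split; first exact: grP.
by rewrite linearP /= dx dy scaler0 addr0.
Qed.

Lemma cobounds0 i : cobounds D i 0.
Proof. by exists 0; [exact: gr0 | exact: linear0]. Qed.

Lemma coboundsP i a x y :
  cobounds D i x -> cobounds D i y -> cobounds D i (a *: x + y).
Proof.
move=> [u ui <-] [v vi <-]; exists (a *: u + v); first exact: grP.
by rewrite linearP.
Qed.

Lemma coboundsZ i a x : cobounds D i x -> cobounds D i (a *: x).
Proof.
by move=> xi; rewrite -[a *: x]addr0; apply: coboundsP => //; apply: cobounds0.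
Qed.

Lemma coboundsD i x y : cobounds D i x -> cobounds D i y -> cobounds D i (x + y).
Proof. by move=> xi; rewrite -[x]scale1r; apply: coboundsP. Qed.

Lemma coboundsN i x : cobounds D i x -> cobounds D i (- x).
Proof. by rewrite -scaleN1r; apply: coboundsZ. Qed.

Lemma coboundsB i x y : cobounds D i x -> cobounds D i y -> cobounds D i (x - y).
Proof. by move=> xi yi; apply: coboundsD => //; apply: coboundsN. Qed.

End GradedSpaces.

(** * Complements of subspaces *)

Section Complement.
Variables (k : fieldType) (V : lmodType k).

Definition subspace (S : set V) : Prop :=
  S 0 /\ forall a x y, S x -> S y -> S (a *: x + y).

Lemma subspaceZ (S : set V) a x : subspace S -> S x -> S (a *: x).
Proof. by move=> [S0 SP] Sx; rewrite -[a *: x]addr0; apply: SP. Qed.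

(** Maximality, by Zorn, among the subspaces that meet S trivially; the empty
    set is let in so that the empty chain has an upper bound. *)
Lemma subspace_complement (S : set V) : subspace S ->
  exists C : set V, [/\ subspace C, forall x, C x -> S x -> x = 0 &
    forall x, exists2 c, C c & S (x - c)].
Proof.
move=> sS; pose Pc (C : set V) :=
  (forall a x y, C x -> C y -> C (a *: x + y)) /\
  (forall x, C x -> S x -> x = 0).
have [F FP totF|C [[CP CS] Cmax]] := @Zorn_bigcup V Pc.
  split=> [a x y [A FA Ax] [B FB By]|x [A FA Ax]]; last exact: (FP A FA).2.
  have [AB|BA] := totF A B FA FB.
  - by exists B => //; apply: (FP B FB).1 => //; apply: AB.
  - by exists A => //; apply: (FP A FA).1 => //; apply: BA.
have C0 : C 0.
  apply: contrapT => nC0; apply: (Cmax [set 0]%classic); last first.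
    by split=> [a x y -> ->|x -> //]; rewrite /= scaler0 addr0.
  split=> [x Cx|sub]; last by apply: nC0; apply: sub.
  by case: nC0; rewrite -[0](addNr x) -scaleN1r; apply: CP.
exists C; split=> // x; apply: contrapT => nx.
pose B y := exists2 c, C c & exists a, y = c + a *: x.
apply: (Cmax B).
  split=> [c Cc|sub]; first by exists c => //; exists 0; rewrite scale0r addr0.
  case: nx; exists x; last by rewrite subrr; apply: sS.1.
  by apply: sub; exists 0 => //; exists 1; rewrite add0r scale1r.
split=> [a _ _ [c Cc [r ->]] [c' Cc' [r' ->]]|_ [c Cc [r ->]] Scx].
  exists (a *: c + c'); first exact: CP.
  exists (a * r + r'); rewrite scalerDr scalerA scalerDl.
  by rewrite -!addrA; congr (_ + _); rewrite addrCA.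
have [r0|r0] := eqVneq r 0.
  by move: Scx; rewrite r0 scale0r addr0 => /CS ->.
case: nx; exists (- r^-1 *: c); first by rewrite -[_ *: c]addr0; apply: CP.
have -> : x - - r^-1 *: c = r^-1 *: (c + r *: x).
  by rewrite scalerDr scalerA mulVf // scale1r scaleNr opprK addrC.
exact: subspaceZ.
Qed.

End Complement.

(** * Morphisms with a parity *)

Section LinearFunctions.
Variables (k : fieldType) (U V : lmodType k) (f : U -> V).
Hypothesis lf : linear f.

Lemma linfD x y : f (x + y) = f x + f y.
Proof. by rewrite -[x in LHS]scale1r lf scale1r. Qed.

Lemma linf0 : f 0 = 0.
Proof. by apply: (addrI (f 0)); rewrite -linfD !addr0. Qed.

Lemma linfZ a x : f (a *: x) = a *: f x.
Proof. by rewrite -[a *: x in LHS]addr0 lf linf0 addr0. Qed.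

Lemma linfN x : f (- x) = - f x.
Proof. by rewrite -scaleN1r linfZ scaleN1r. Qed.

Lemma linfB x y : f (x - y) = f x - f y.
Proof. by rewrite linfD linfN. Qed.

End LinearFunctions.

Section Signs.
Variable k : fieldType.

Lemma ksignD i j : ksign k (i + j) = ksign k i * ksign k j.
Proof. by rewrite /ksign expfzDr // oppr_eq0 oner_eq0. Qed.

Lemma ksignB1 i : ksign k (i - 1) = - ksign k i.
Proof.
by rewrite -[in RHS](subrK 1 i) (ksignD (i - 1)) [ksign k 1]expr1z mulrN1 opprK.
Qed.

Definition parity (n : int) : bool := odd `|n|%N.

Lemma ksign_parity n : ksign k n = (-1) ^+ parity n.
Proof.
rewrite /ksign /parity signr_odd; case: n => n //.
by rewrite -[X in _ = X]invr_sign.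
Qed.

Lemma ksign_sq i : ksign k i * ksign k i = 1.
Proof. by rewrite ksign_parity -signr_addb addbb. Qed.

(** The Koszul sign for moving a map of parity [e] past an element of degree
    [i]. *)
Definition psign (e : bool) (i : int) : k := if e then ksign k i else 1.

Lemma ksignM n i : ksign k (n * i) = psign (parity n) i.
Proof.
rewrite {1}/ksign -exprz_exp -/(ksign k n) ksign_parity /psign.
by case: parity; rewrite ?expr1 // expr0 exp1rz.
Qed.

Lemma psign_addb e e' i : psign (e (+) e') i = psign e i * psign e' i.
Proof.
by case: e; case: e'; rewrite /psign /= ?ksign_sq ?mulr1 ?mul1r.
Qed.

Lemma parityB1 n : parity (n - 1) = ~~ parity n.
Proof. by rewrite /parity; lia. Qed.

End Signs.

Section DGActions.
Variables (k : fieldType) (R : dgAlg k) (A : dgMod R).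

Lemma act0r r : act r (0 : A) = 0.
Proof. exact: (linf0 (act_linearr r)). Qed.
Lemma act0l (x : A) : act 0 x = 0.
Proof. exact: (linf0 (act_linearl x)). Qed.
Lemma actDr r (x y : A) : act r (x + y) = act r x + act r y.
Proof. exact: (linfD (act_linearr r)). Qed.
Lemma actDl r s (x : A) : act (r + s) x = act r x + act s x.
Proof. exact: (linfD (act_linearl x)). Qed.
Lemma actZr r a (x : A) : act r (a *: x) = a *: act r x.
Proof. exact: (linfZ (act_linearr r)). Qed.
Lemma actZl r a (x : A) : act (a *: r) x = a *: act r x.
Proof. exact: (linfZ (act_linearl x)). Qed.
End DGActions.

Section Morphisms.
Variables (k : fieldType) (R : dgAlg k).
Implicit Types (A B C : dgMod R) (e : bool) (n : int).

Local Notation d A := (diff (dgm_dg A)).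

(** In a Koszul complex of homomorphisms the parity of a map is that of its
    degree. Separating the two lets a shift change the degrees without any
    sign, in the action and the differential of a cone as well. *)
Definition phom e n A B (f : A -> B) : Prop :=
  [/\ linear f,
     forall i x, gr (dgm_dg A) i x -> gr (dgm_dg B) (i + n) (f x) &
     forall i r x, gr (dga_dg R) i r ->
       f (act r x) = psign k e i *: act r (f x)].

Definition pcocycle e n A B (f : A -> B) : Prop :=
  phom e n f /\ forall x, d B (f x) = (-1) ^+ e *: f (d A x).

Definition pcobound e n A B (f : A -> B) : Prop :=
  exists2 h : A -> B, phom (~~ e) (n - 1) h &
    forall x, f x = d B (h x) + (-1) ^+ e *: h (d A x).

Lemma phom_linear e n A B (f : A -> B) : phom e n f -> linear f.
Proof. by case. Qed.

Lemma phom_gr e n A B (f : A -> B) i j x : phom e n f -> j = i + n ->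
  gr (dgm_dg A) i x -> gr (dgm_dg B) j (f x).
Proof. by move=> [_ fgr _] ->; apply: fgr. Qed.

Lemma phom_act e n A B (f : A -> B) i r x : phom e n f ->
  gr (dga_dg R) i r -> f (act r x) = psign k e i *: act r (f x).
Proof. by move=> [_ _ fact]; apply: fact. Qed.

Lemma phom_comp e e' n n' A B C (f : A -> B) (g : B -> C) :
  phom e n f -> phom e' n' g -> phom (e (+) e') (n + n') (g \o f).
Proof.
move=> [lf fgr fact] [lg ggr gact]; split=> [a x y|i x xi|i r x ri] /=.
- by rewrite lf lg.
- by rewrite addrA; apply/ggr/fgr.
- by rewrite (fact i) // (linfZ lg) (gact i) // scalerA psign_addb.
Qed.

Lemma pcocycle_comp e e' n n' A B C (f : A -> B) (g : B -> C) :
  pcocycle e n f -> pcocycle e' n' g -> pcocycle (e (+) e') (n + n') (g \o f).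
Proof.
move=> [fh fd] [gh gd]; split; first exact: phom_comp fh gh.
move=> x /=; rewrite gd fd (linfZ (phom_linear gh)) scalerA.
by rewrite mulrC -signr_addb.
Qed.

Lemma pcobound_compl e n n' A B C (f : A -> B) (g : B -> C) :
  pcobound e n f -> pcocycle false n' g -> pcobound e (n + n') (g \o f).
Proof.
move=> [h hh fE] [gh gd]; exists (g \o h).
  by rewrite addrAC -[~~ e]addbF; apply: phom_comp hh gh.
move=> x /=; rewrite fE (linfD (phom_linear gh)) (linfZ (phom_linear gh)).
by rewrite gd expr0 scale1r.
Qed.

(** For P a resolution of N, [contractible_hom n P M] says that
    Ext^n(N, M) = 0. *)
Definition contractible_hom n A B : Prop :=
  forall e (f : A -> B), pcocycle e n f -> pcobound e n f.

End Morphisms.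

Section Twist.
Variables (k : fieldType) (V : lmodType k) (D : dgStruct V).

(** The sign involution, multiplication by (-1)^i in degree [i]. It is an odd
    morphism of degree 0, so composing with it changes the parity. *)
Definition twist (x : V) : V :=
  \sum_(i <- s2val (cid2 (dproj_supp D x))) ksign k i *: dproj D i x.

Lemma dproj_twist i x : dproj D i (twist x) = ksign k i *: dproj D i x.
Proof.
rewrite /twist; case: cid2 => s us xs /=.
by rewrite dproj_sumE //; case: ifPn => // /xs ->; rewrite scaler0.
Qed.

Lemma twist_linear : linear twist.
Proof.
move=> a x y; apply: (dproj_inj (D := D)) => i.
rewrite dproj_twist linearP /= scalerDr linearP /= !dproj_twist !scalerA.
by rewrite mulrC.
Qed.

Lemma twist_gr i x : gr D i x -> twist x = ksign k i *: x.
Proof.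
move=> xi; apply: (dproj_inj (D := D)) => j; rewrite dproj_twist linearZ /=.
have [->|ji] := eqVneq j i; first by [].
by rewrite (dproj_gr_ne xi ji) !scaler0.
Qed.

Lemma twistK x : twist (twist x) = x.
Proof.
apply: (dproj_inj (D := D)) => i.
by rewrite !dproj_twist scalerA ksign_sq scale1r.
Qed.

Lemma diff_twist x : diff D (twist x) = - twist (diff D x).
Proof.
apply: (dproj_inj (D := D)) => i.
rewrite linearN /= dproj_twist !dproj_diff dproj_twist linearZ /=.
by rewrite ksignB1 scaleNr.
Qed.

End Twist.

Section ParityChange.
Variables (k : fieldType) (R : dgAlg k).
Implicit Types (A B : dgMod R).

Lemma pcocycle_twist A : pcocycle true 0 (twist (dgm_dg A)).
Proof.
split; last by move=> x; rewrite diff_twist expr1 scaleN1r.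
split=> [|i x xi|i r x ri]; first exact: twist_linear.
  by rewrite addr0 (twist_gr xi); apply: grZ.
move: x; apply: (gr_ind (D := dgm_dg A)) => [|x y|j x xj].
- by rewrite act0r (linf0 (twist_linear _)) act0r scaler0.
- by rewrite actDr !(linfD (twist_linear _)) actDr scalerDr => -> ->.
- by rewrite (twist_gr (act_deg ri xj)) (twist_gr xj) actZr scalerA ksignD.
Qed.

Lemma pcobound_twist e n A B (f : A -> B) :
  pcobound e n f -> pcobound (~~ e) n (f \o twist (dgm_dg A)).
Proof.
move=> [h hh fE]; exists (h \o twist (dgm_dg A)).
  have := phom_comp (pcocycle_twist A).1 hh.
  by rewrite add0r addTb.
move=> x /=; rewrite fE diff_twist (linfN (phom_linear hh)) scalerN -scaleNr.
by rewrite signrN.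
Qed.

(** If [f] has the other parity, apply the hypothesis to the composite of [f]
    with the twist, and untwist the homotopy. *)
Lemma contractible_hom_parity e n A B :
  (forall f : A -> B, pcocycle e n f -> pcobound e n f) ->
  contractible_hom n A B.
Proof.
move=> He e' f fc; have [ee'|ee'] := boolP (e == e').
  by rewrite -(eqP ee') in fc *; apply: He.
have {ee'} e'E : e' = ~~ e by move: ee'; rewrite negb_eqb => /addbP <-.
have : pcobound e n (f \o twist (dgm_dg A)).
  apply: He; have := pcocycle_comp (pcocycle_twist A) fc.
  by rewrite add0r addTb e'E negbK.
move/pcobound_twist; rewrite -e'E; congr pcobound.
by apply: funext => x /=; rewrite twistK.
Qed.

Lemma phom_dghom n A B (f : A -> B) :
  phom (parity n) n f <-> (@dghom _ _ A B n f).
Proof.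
by split=> -[lf fgr fact]; split=> // i r x ri; rewrite (fact i) // ksignM.
Qed.

(** The case of maps of the parity of [n], to which
    [contractible_hom_parity] reduces the general one, is the exactness of the
    complex of homomorphisms at [n]. *)
Lemma contractible_homP n A B :
  contractible_hom n A B <->
  (dghom_cocycles n `<=` @dghom_cobounds _ _ A B n)%classic.
Proof.
split=> [He f [fh fd]|sub].
  have [] := He (parity n) f.
    split; first exact/phom_dghom.
    by move=> x; apply/eqP; rewrite -ksign_parity -subr_eq0; apply/eqP/fd.
  move=> h hh fE; exists h; first by apply/phom_dghom; rewrite parityB1.
  apply: funext => x; rewrite fE /dghom_diff ksign_parity parityB1.
  by rewrite signrN scaleNr opprK.
apply: (@contractible_hom_parity (parity n)) => f [fh fd].
have [|h /phom_dghom hh fE] := sub f.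
  split; first exact/phom_dghom.
  by move=> x; rewrite /dghom_diff fd ksign_parity subrr.
exists h; first by rewrite -parityB1.
move=> x; rewrite -fE /dghom_diff ksign_parity parityB1.
by rewrite signrN scaleNr opprK.
Qed.

Lemma K_projective_contractible X B n :
  K_projective X -> acyclic (dgm_dg B) -> contractible_hom n X B.
Proof. by move=> KX aB; apply/contractible_homP; apply: KX. Qed.

End ParityChange.

(** * Cones *)

Section Cone.
Variables (k : fieldType) (R : dgAlg k) (A B : dgMod R) (n : int) (f : A -> B).
Hypothesis fc : pcocycle true n f.

Let lf : linear f. Proof. exact: phom_linear fc.1. Qed.

Let C : lmodType k := (B * A)%type.

Definition cone_proj (i : int) (x : C) : C :=
  (dproj (dgm_dg B) i x.1, dproj (dgm_dg A) (i + 1 - n) x.2).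
Definition cone_diff (x : C) : C :=
  (diff (dgm_dg B) x.1 + f x.2, diff (dgm_dg A) x.2).

Let cone_proj_linear i : linear (cone_proj i).
Proof. by move=> a x y; rewrite /cone_proj /= !linearP. Qed.

Let cone_projE i j x :
  cone_proj i (cone_proj j x) = if i == j then cone_proj j x else 0.
Proof.
rewrite /cone_proj /= !dprojE (inj_eq (addIr _)) (inj_eq (addIr _)).
by case: eqP.
Qed.

Let cone_proj_sum x :
  exists2 s : seq int, uniq s & x = \sum_(i <- s) cone_proj i x.
Proof.
have [s1 _ xs1] := dproj_supp (dgm_dg B) x.1.
have [s2 _ xs2] := dproj_supp (dgm_dg A) x.2.
pose s := undup (s1 ++ [seq i - (1 - n) | i <- s2]).
exists s; first exact: undup_uniq.
have fst_sum (F : int -> C) : (\sum_(i <- s) F i).1 = \sum_(i <- s) (F i).1.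
  by apply: (big_morph (fun z : C => z.1)).
have snd_sum (F : int -> C) : (\sum_(i <- s) F i).2 = \sum_(i <- s) (F i).2.
  by apply: (big_morph (fun z : C => z.2)).
apply: injective_projections; rewrite ?fst_sum ?snd_sum.
  apply: dproj_suppE (undup_uniq _) _ => i; rewrite mem_undup mem_cat.
  by rewrite negb_or => /andP[/xs1].
rewrite (eq_bigr (fun i => dproj (dgm_dg A) (i + (1 - n)) x.2)); last first.
  by move=> i _; rewrite /= addrA.
rewrite -(big_map (fun i => i + (1 - n)) predT (dproj (dgm_dg A) ^~ x.2)).
apply: dproj_suppE => [|i].
  by rewrite map_inj_uniq ?undup_uniq //; apply: addIr.
rewrite -[i in i \notin _](subrK (1 - n)) (mem_map (addIr _)).
rewrite mem_undup mem_cat negb_or => /andP[_].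
by rewrite (mem_map (addIr _)) => /xs2.
Qed.

Let cone_diff_linear : linear cone_diff.
Proof.
move=> a [b1 a1] [b2 a2]; apply: (congr2 pair).
  by rewrite /= linearP lf /= scalerDr addrACA.
by rewrite /= linearP.
Qed.

Let cone_diff_deg i x :
  cone_proj i x = x -> cone_proj (i + 1) (cone_diff x) = cone_diff x.
Proof.
case: x => b a [bi ai]; rewrite /cone_proj /cone_diff /=; congr pair; last first.
  by apply: gr_diff ai; rewrite addrAC.
apply: grD; first exact: gr_diff bi.
by apply: (phom_gr fc.1 _ ai); rewrite subrK.
Qed.

Let cone_diffK x : cone_diff (cone_diff x) = 0.
Proof.
rewrite /cone_diff /= linearD /= !diffK add0r fc.2 expr1 scaleN1r addNr.
by [].
Qed.

Definition cone_dg : dgStruct C :=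
  DgStruct cone_proj_linear cone_projE cone_proj_sum cone_diff_linear
    cone_diff_deg cone_diffK.

Definition cone_act (r : R) (x : C) : C := (act r x.1, act r x.2).

Let cone_act_linearl x : linear (cone_act^~ x).
Proof. by move=> a r s; rewrite /cone_act !act_linearl. Qed.

Let cone_act_linearr r : linear (cone_act r).
Proof. by move=> a x y; rewrite /cone_act /= !act_linearr. Qed.

Let cone_actA r s x : cone_act r (cone_act s x) = cone_act (r * s) x.
Proof. by rewrite /cone_act /= !actA. Qed.

Let cone_act1 x : cone_act 1 x = x.
Proof. by rewrite /cone_act !act1; case: x. Qed.

Let cone_act_deg i j r x : gr (dga_dg R) i r -> gr cone_dg j x ->
  gr cone_dg (i + j) (cone_act r x).
Proof.
move=> ri; case: x => b a [bj aj]; rewrite /gr /= /cone_proj /cone_act /=.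
congr pair; first exact: act_deg.
by rewrite -!addrA [j + _]addrA; apply: act_deg.
Qed.

Let cone_act_leibniz i r x : gr (dga_dg R) i r ->
  diff cone_dg (cone_act r x)
  = cone_act (diff (dga_dg R) r) x
    + ksign k i *: cone_act r (diff cone_dg x).
Proof.
move=> ri; rewrite /= /cone_diff /cone_act /= !(act_leibniz _ ri).
congr pair => /=; rewrite actDr scalerDr addrA; congr (_ + _).
exact: (phom_act _ fc.1 ri).
Qed.

(** The shift of [A] involves no sign, neither in the action nor in the
    differential: the oddness of [f] accounts for them. *)
Definition cone : dgMod R :=
  DgMod cone_act_linearl cone_act_linearr cone_actA cone_act1 cone_act_deg
    cone_act_leibniz.

Lemma gr_cone i (b : B) (a : A) : gr (dgm_dg cone) i (b, a) <->
  gr (dgm_dg B) i b /\ gr (dgm_dg A) (i + 1 - n) a.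
Proof. by split=> [[bi ai]|[bi ai]]; [split | congr pair]. Qed.

Lemma diff_cone (b : B) (a : A) : diff (dgm_dg cone) (b, a) =
  (diff (dgm_dg B) b + f a, diff (dgm_dg A) a).
Proof. by []. Qed.

Lemma cone_in_pcocycle : pcocycle false 0 (fun b : B => (b, 0) : cone).
Proof.
split; last first.
  by move=> b; rewrite scale1r /= /cone_diff /= (linf0 lf) addr0 linear0.
split=> [a x y|i x xi|i r x ri].
- by congr pair; rewrite /= scaler0 addr0.
- by rewrite addr0; congr pair; rewrite // linear0.
- by rewrite scale1r; congr pair; rewrite act0r.
Qed.

(** On [B] a cocycle [g] out of the cone is the coboundary of some [hB]; the
    rest [g - hB \o f] on [A] is then a cocycle, and a primitive [hA] of it
    completes [hB] to a primitive of [g]. *)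
Lemma cone_K_projective : K_projective A -> K_projective B -> K_projective cone.
Proof.
move=> KA KB N aN m; apply/contractible_homP.
apply: (@contractible_hom_parity _ _ false) => g gc.
have lg := phom_linear gc.1.
have [hB hBh hBE] :=
  K_projective_contractible KB aN (pcocycle_comp cone_in_pcocycle gc).
have {}hBE b : g (b, 0) = diff (dgm_dg N) (hB b) + hB (diff (dgm_dg B) b).
  by rewrite -[g _]/((g \o (fun b => (b, 0))) b) hBE scale1r.
have gE (b : B) (a : A) : g (b, a) = g (b, 0) + g (0, a).
  rewrite -(linfD lg); congr g.
  by apply: (congr2 pair); rewrite /= ?addr0 ?add0r.
pose gA (a : A) : N := g (0, a) - hB (f a).
have gAc : pcocycle false (n + m - 1) gA.
  have hBf := phom_comp fc.1 hBh.
  split; last first.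
    move=> a; rewrite linearB /= gc.2 !scale1r /= /cone_diff /= linear0 add0r.
    rewrite gE hBE fc.2 expr1 scaleN1r (linfN (phom_linear hBh)) /gA.
    by rewrite addrC !addrA addNr add0r addrC.
  split=> [c x y|i x xi|i r x ri].
  - rewrite /gA lf (phom_linear hBh) scalerBr addrACA -opprD; congr (_ - _).
    rewrite -lg; congr g.
    by apply: (congr2 pair); rewrite /= ?scaler0 ?addr0.
  - apply: grB; last by apply: (phom_gr hBf _ xi); rewrite add0r !addrA.
    apply: (phom_gr gc.1 (i := i + n - 1)); first by ring.
    by congr pair; rewrite ?linear0 // subrK addrK.
  - rewrite scale1r (linfB (act_linearr r)) /gA; congr (_ - _).
      rewrite -[RHS]scale1r -(phom_act _ gc.1 ri).
      by congr g; apply: (congr2 pair); rewrite //= act0r.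
    by have := phom_act x hBf ri; rewrite scale1r.
have [hA hAh hAE] := K_projective_contractible KA aN gAc.
exists (fun x : cone => hB x.1 + hA x.2).
  split=> [c x y|i [b a] /gr_cone[xi1 xi2]|i r x ri].
  - by rewrite /= (phom_linear hBh) (phom_linear hAh) scalerDr addrACA.
  - apply: (@grD _ _ _ _ (hB b) (hA a)).
      by apply: (phom_gr hBh _ xi1); rewrite add0r.
    by apply: (phom_gr hAh _ xi2); ring.
  - by rewrite /= (phom_act _ hBh ri) (phom_act _ hAh ri) -scalerDr actDr.
move=> [b a]; rewrite gE scale1r linearD /= (linfD (phom_linear hBh)).
rewrite hBE -[g (0, a)](subrK (hB (f a))) -/(gA a) hAE scale1r.
rewrite -!addrA; congr (_ + _); rewrite [RHS]addrCA; congr (_ + _).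
by congr (_ + _); rewrite addrC.
Qed.

(** A primitive of [g \o f] provides the component of [G] on [A]. *)
Lemma cone_extension (N : dgMod R) m (g : B -> N) :
  pcocycle false m g -> pcobound true (n + m) (g \o f) ->
  exists2 G : cone -> N, pcocycle false m G & forall b, G (b, 0) = g b.
Proof.
move=> gc [h hh hE]; have lg := phom_linear gc.1; have lh := phom_linear hh.
exists (fun x : cone => g x.1 + h x.2); last first.
  by move=> b; rewrite (linf0 lh) addr0.
split; last first.
  move=> [b a]; rewrite linearD /= gc.2 !scale1r (linfD lg) -addrA.
  by congr (_ + _); rewrite [g (f a)]hE scaleN1r subrK.
split=> [c x y|i [b a] /gr_cone[bi ai]|i r x ri].
- by rewrite /= lg lh scalerDr addrACA.
- apply: (@grD _ _ _ _ (g b) (h a)); first exact: (phom_gr gc.1 _ bi).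
  by apply: (phom_gr hh _ ai); ring.
- by rewrite /= (phom_act _ gc.1 ri) (phom_act _ hh ri) -scalerDr actDr.
Qed.

End Cone.

(** * DG submodules *)

Section SubspaceType.
Variables (k : fieldType) (V : lmodType k) (S : set V) (sS : subspace S).

(** The argument of type [subspace S] lets the closure properties of the
    predicate be found as canonical instances. *)
Definition subspace_pred of subspace S : {pred V} := fun x => `[< S x >].

Let subspace_pred_closed : submod_closed (subspace_pred sS).
Proof.
split=> [|a x y /asboolP Sx /asboolP Sy]; apply/asboolP; first exact: sS.1.
exact: sS.2.
Qed.

HB.instance Definition _ :=
  GRing.isSubmodClosed.Build k V (subspace_pred sS) subspace_pred_closed.

Definition subspace_type := {x : V | x \in subspace_pred sS}.

HB.instance Definition _ := [isSub of subspace_type for @sval _ _].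
HB.instance Definition _ := [Choice of subspace_type by <:].
HB.instance Definition _ := [SubChoice_isSubLmodule of subspace_type by <:].

End SubspaceType.

Section Submodule.
Variables (k : fieldType) (R : dgAlg k) (A : dgMod R) (S : set A).

Record dg_submodule : Prop := {
  dgs_subspace : subspace S;
  dgs_proj : forall i x, S x -> S (dproj (dgm_dg A) i x);
  dgs_diff : forall x, S x -> S (diff (dgm_dg A) x);
  dgs_act : forall r x, S x -> S (act r x)
}.

Hypothesis hS : dg_submodule.

Let T : lmodType k := subspace_type (dgs_subspace hS).

Let va (x : T) : A := sval x.

Let va_inj : injective va. Proof. exact: val_inj. Qed.

Let vaS (x : T) : S (va x).
Proof. by apply/asboolP; exact: (valP x). Qed.

Let into (x : A) (Sx : S x) : T := Sub x (asboolT Sx).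

Let vaK x Sx : va (@into x Sx) = x. Proof. by []. Qed.

Let vaP : linear va.
Proof. by []. Qed.

Let sub_proj i (x : T) : T := into (dgs_proj hS i (vaS x)).
Let sub_diff (x : T) : T := into (dgs_diff hS (vaS x)).
Let sub_act r (x : T) : T := into (dgs_act hS r (vaS x)).

Let sub_proj_linear i : linear (sub_proj i).
Proof.
by move=> a x y; apply: va_inj; rewrite vaP !vaK vaP linearP.
Qed.

Let sub_projE i j x :
  sub_proj i (sub_proj j x) = if i == j then sub_proj j x else 0.
Proof.
by apply: va_inj; rewrite !vaK dprojE; case: eqP; rewrite ?(linf0 vaP) ?vaK.
Qed.

Let sub_proj_sum x :
  exists2 s : seq int, uniq s & x = \sum_(i <- s) sub_proj i x.
Proof.
have [s us xs] := dproj_sum (dgm_dg A) (va x); exists s => //.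
apply: va_inj; rewrite [LHS]xs (big_morph va (linfD vaP) (linf0 vaP)).
by apply: eq_bigr => i _; rewrite vaK.
Qed.

Let sub_diff_linear : linear sub_diff.
Proof.
by move=> a x y; apply: va_inj; rewrite vaP !vaK vaP linearP.
Qed.

Let sub_diff_deg i x :
  sub_proj i x = x -> sub_proj (i + 1) (sub_diff x) = sub_diff x.
Proof.
move=> /(congr1 va); rewrite vaK => xi; apply: va_inj; rewrite !vaK.
exact: diff_deg.
Qed.

Let sub_diffK x : sub_diff (sub_diff x) = 0.
Proof. by apply: va_inj; rewrite !vaK diffK (linf0 vaP). Qed.

Definition submodule_dg : dgStruct T :=
  DgStruct sub_proj_linear sub_projE sub_proj_sum sub_diff_linear sub_diff_deg
    sub_diffK.

Let gr_va i x : gr submodule_dg i x <-> gr (dgm_dg A) i (va x).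
Proof.
split=> [/(congr1 va)|xi]; first by rewrite vaK.
by apply: va_inj; rewrite vaK.
Qed.

Let sub_act_linearl x : linear (sub_act^~ x).
Proof.
by move=> a r s; apply: va_inj; rewrite vaP !vaK act_linearl.
Qed.

Let sub_act_linearr r : linear (sub_act r).
Proof.
by move=> a x y; apply: va_inj; rewrite vaP !vaK vaP act_linearr.
Qed.

Let sub_actA r s x : sub_act r (sub_act s x) = sub_act (r * s) x.
Proof. by apply: va_inj; rewrite !vaK actA. Qed.

Let sub_act1 x : sub_act 1 x = x.
Proof. by apply: va_inj; rewrite !vaK act1. Qed.

Let sub_act_deg i j r x : gr (dga_dg R) i r -> gr submodule_dg j x ->
  gr submodule_dg (i + j) (sub_act r x).
Proof.
by move=> ri /gr_va xj; apply/gr_va; rewrite vaK; apply: act_deg.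
Qed.

Let sub_act_leibniz i r x : gr (dga_dg R) i r ->
  diff submodule_dg (sub_act r x)
  = sub_act (diff (dga_dg R) r) x
    + ksign k i *: sub_act r (diff submodule_dg x).
Proof.
move=> ri; apply: va_inj.
by rewrite addrC vaP !vaK addrC; apply: act_leibniz.
Qed.

Definition submodule : dgMod R :=
  DgMod sub_act_linearl sub_act_linearr sub_actA sub_act1 sub_act_deg
    sub_act_leibniz.

Definition sub_incl (x : submodule) : A := val (x : T).

Lemma sub_incl_in x : S (sub_incl x). Proof. exact: vaS. Qed.

Lemma sub_incl_inj : injective sub_incl. Proof. exact: va_inj. Qed.

Lemma sub_incl_onto x : S x -> exists y, sub_incl y = x.
Proof. by move=> Sx; exists (into Sx); apply: vaK. Qed.

Lemma sub_incl_gr i x : gr (dgm_dg submodule) i x <-> gr (dgm_dg A) i (sub_incl x).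
Proof. exact: gr_va. Qed.

Lemma sub_incl_pcocycle : pcocycle false 0 sub_incl.
Proof.
split; last by move=> x; rewrite scale1r.
split=> [a x y|i x /sub_incl_gr xi|i r x ri]; first exact: vaP.
  by rewrite addr0.
by rewrite scale1r.
Qed.

Lemma sub_incl0 : sub_incl 0 = 0.
Proof. exact: linf0 vaP. Qed.

Lemma sub_incl_diff x :
  sub_incl (diff (dgm_dg submodule) x) = diff (dgm_dg A) (sub_incl x).
Proof. by []. Qed.

Lemma odd_incl_pcocycle : pcocycle true 0 (sub_incl \o twist (dgm_dg submodule)).
Proof. exact: (pcocycle_comp (pcocycle_twist submodule) sub_incl_pcocycle). Qed.

Lemma pcocycle_factor e n (B : dgMod R) (f : B -> A) : pcocycle e n f ->
  (forall x, S (f x)) ->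
  exists2 g : B -> submodule, pcocycle e n g & forall x, sub_incl (g x) = f x.
Proof.
move=> [[lf fgr fact] fd] Sf; exists (fun x => into (Sf x)) => //.
have inclP := phom_linear sub_incl_pcocycle.1.
have inclZ a x : sub_incl (a *: x) = a *: sub_incl x by apply: linfZ.
split; [split=> [a x y|i x xi|i r x ri]|move=> x].
- by apply: sub_incl_inj; rewrite inclP; apply: lf.
- by apply/sub_incl_gr; apply: fgr.
- by apply: sub_incl_inj; rewrite inclZ; apply: fact.
- by apply: sub_incl_inj; rewrite inclZ; apply: fd.
Qed.

End Submodule.

(** * Truncations *)

Section Truncation.
Variables (k : fieldType) (R : dgAlg k) (scR : simply_connected R).
Implicit Types (A X : dgMod R).

Lemma dproj_act A i j r (x : A) : gr (dga_dg R) i r ->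
  dproj (dgm_dg A) j (act r x) = act r (dproj (dgm_dg A) (j - i) x).
Proof.
move=> ri; move: x; apply: (gr_ind (D := dgm_dg A)) => [|x y|l x xl].
- by rewrite linear0 !act0r linear0.
- by rewrite linearD !actDr linearD /= => -> ->.
have rx := act_deg ri xl; have [->|jl] := eqVneq j (i + l).
  by rewrite rx addrAC subrr add0r xl.
rewrite (dproj_gr_ne rx jl) (dproj_gr_ne xl) ?act0r //.
by apply: contra jl => /eqP <-; rewrite addrC subrK.
Qed.

Definition trunc A (m : int) (C : set A) : set A :=
  [set x | (forall i, i < m -> dproj (dgm_dg A) i x = 0) /\
           C (dproj (dgm_dg A) m x)]%classic.

Section TruncLemmas.
Variables (A : dgMod R) (m : int) (C : set A).
Hypothesis sC : subspace C.

(** An element of R of positive degree raises degrees, and those of degree 0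
    are scalars, so any subspace may serve as the lowest component. *)
Lemma trunc_submodule : dg_submodule (trunc m C).
Proof.
have sT : subspace (trunc m C).
  split; first by split=> [i _|]; rewrite linear0 //; apply: sC.1.
  move=> a x y [x0 xC] [y0 yC]; split=> [i im|]; rewrite linearP /=.
    by rewrite x0 // y0 // scaler0 addr0.
  exact: sC.2.
split=> [//|i x [x0 xC]|x [x0 xC]|r x [x0 xC]].
- split=> [j jm|]; rewrite dprojE.
    by case: eqP => [<-|//]; apply: x0.
  by case: eqP => [<- //|_]; apply: sC.1.
- split=> [i im|]; rewrite dproj_diff x0 ?linear0 //; first by lia.
    exact: sC.1.
  by lia.
move: r; apply: (gr_ind (D := dga_dg R)) => [|r s Tr Ts|i r ri].
- by rewrite act0l; apply: sT.1.
- by rewrite actDl -[act r x]scale1r; apply: sT.2.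
have [i0|i0|i0] := ltgtP i 0.
- by rewrite (sc_neg scR i0 ri) act0l; apply: sT.1.
- split=> [j jm|]; rewrite (dproj_act _ _ ri) x0 ?act0r //; try lia.
  exact: sC.1.
- rewrite i0 in ri; have [c ->] := sc_zero scR ri.
  by rewrite actZl act1; apply: subspaceZ.
Qed.

Lemma trunc_gr_lt i x : trunc m C x -> gr (dgm_dg A) i x -> i < m -> x = 0.
Proof. by move=> [x0 _] xi im; rewrite -xi x0. Qed.

Lemma trunc_gr_eq x : trunc m C x -> gr (dgm_dg A) m x -> C x.
Proof. by move=> [_ +] xi; rewrite xi. Qed.

Lemma gr_trunc i x : gr (dgm_dg A) i x -> m < i -> trunc m C x.
Proof.
move=> xi im; split=> [j jm|]; rewrite (dproj_gr_ne xi); first by [].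
- by apply/eqP; lia.
- exact: sC.1.
- by apply/eqP; lia.
Qed.

Lemma gr_trunc_eq x : gr (dgm_dg A) m x -> C x -> trunc m C x.
Proof.
move=> xm Cx; split=> [j jm|]; last by rewrite xm.
by rewrite (dproj_gr_ne xm) //; apply/eqP; lia.
Qed.

End TruncLemmas.

(** The lowest component is a complement of the cocycles: the differential is
    injective on it and has the same image as on the full component, which
    kills the cohomology in that degree and does not disturb the next one. *)
Lemma acyclic_truncation A m : (forall i, m < i -> coh_zero (dgm_dg A) i) ->
  exists2 C : set A, subspace C &
    forall hT : dg_submodule (trunc m C), acyclic (dgm_dg (submodule hT)).
Proof.
move=> Hm; have [|C [sC CZ Cc]] :=
  @subspace_complement _ _ (cocycles (dgm_dg A) m).
  by split; [exact: cocycles0 | exact: cocyclesP].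
exists C => // hT i x [/sub_incl_gr xi /(congr1 (@sub_incl _ _ _ _ hT))].
rewrite sub_incl_diff sub_incl0 => dx.
have Tx := sub_incl_in x.
have [im|im|im] := ltgtP i m.
- suff -> : x = 0 by apply: cobounds0.
  apply: (@sub_incl_inj _ _ _ _ hT).
  rewrite sub_incl0.
  exact: trunc_gr_lt Tx xi im.
- have [y yi xE] := Hm i im _ (conj xi dx).
  have [z [zi Tz zE]] : exists z, [/\ gr (dgm_dg A) (i - 1) z, trunc m C z &
      diff (dgm_dg A) z = sub_incl x].
    have [mi|im1] := ltP m (i - 1).
      by exists y; split=> //; apply: gr_trunc yi mi.
    have im2 : i - 1 = m by lia.
    rewrite im2 in yi *; have [c Cc' [ycm dyc]] := Cc y.
    have cm : gr (dgm_dg A) m c by rewrite -[c](subKr y); apply: grB.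
    exists c; split=> //; first exact: gr_trunc_eq.
    by rewrite -xE -[y in RHS](subrK c) linearD /= dyc add0r.
  have [w wz] := sub_incl_onto hT Tz; exists w; first by apply/sub_incl_gr; rewrite wz.
  by apply: (@sub_incl_inj _ _ _ _ hT); rewrite sub_incl_diff wz.
- suff -> : x = 0 by apply: cobounds0.
  apply: (@sub_incl_inj _ _ _ _ hT).
  rewrite sub_incl0.
  rewrite im in xi dx; apply: CZ; last by split.
  exact: trunc_gr_eq Tx xi.
Qed.

(** With a complement of the coboundaries in degree [s], the inclusion of the
    truncation is a quasi-isomorphism: in degree [s] the complement keeps one
    cocycle in each class, and it has the same image under the differential as
    the full component. *)
Lemma lower_truncation X (s : int) : (forall i, i < s -> coh_zero (dgm_dg X) i) ->
  exists2 C : set X, subspace C &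
    forall hT : dg_submodule (trunc s C),
      acyclic (dgm_dg (cone (odd_incl_pcocycle hT))).
Proof.
move=> Hs; have [|C [sC CB Cc]] :=
  @subspace_complement _ _ (cobounds (dgm_dg X) s).
  by split; [exact: cobounds0 | exact: coboundsP].
exists C => // hT; have := odd_incl_pcocycle hT.
set j := (_ \o _) => jc i [x u] [/gr_cone[xi ui] [dx du]].
rewrite subr0 in ui.
have lj := phom_linear jc.1.
have jS v : trunc s C (j v) by apply: sub_incl_in.
have jK : injective j.
  by move=> v w /sub_incl_inj /(congr1 (twist (dgm_dg (submodule hT)))); rewrite !twistK.
have dxE : diff (dgm_dg X) x = - j u by apply/eqP; rewrite -addr_eq0 dx.
have [x' x'i Tx] : exists2 x', gr (dgm_dg X) (i - 1) x' &
    trunc s C (x - diff (dgm_dg X) x').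
  have [si|is1] := ltP s i.
    exists 0; first exact: gr0.
    by rewrite linear0 subr0; apply: (gr_trunc sC xi si).
  have [si|si] := eqVneq s i.
    have [c Cx [x' x'i x'E]] := Cc x; rewrite -si; exists x' => //.
    have cE : x - diff (dgm_dg X) x' = c by rewrite x'E opprB addrC subrK.
    by rewrite cE; apply: gr_trunc_eq => //; rewrite -cE x'E; apply: grB;
      rewrite ?si // -si -x'E; apply: gr_diffB.
  have {}is1 : i < s by lia.
  have ju : j u = 0.
    have jui : gr (dgm_dg X) (i + 1) (j u).
      by apply: (phom_gr jc.1 _ ui); rewrite addr0.
    have [i1s|i1s] := ltP (i + 1) s; first exact: trunc_gr_lt (jS u) jui i1s.
    have {i1s} i1s : i + 1 = s by lia.
    rewrite i1s in jui; apply: CB; first exact: trunc_gr_eq (jS u) jui.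
    exists (- x); first by rewrite -i1s addrK; apply: grN.
    by rewrite linearN /= dxE opprK.
  have [|x' x'i x'E] := Hs i is1 x.
    by split=> //; rewrite dxE ju oppr0.
  exists x' => //; rewrite x'E subrr.
  exact: (trunc_submodule s sC).(dgs_subspace).1.
have [v vE] := sub_incl_onto hT Tx.
have juE : j (twist (dgm_dg (submodule hT)) v) = x - diff (dgm_dg X) x'.
  by rewrite /j /= twistK.
exists (x', twist (dgm_dg (submodule hT)) v).
  apply/gr_cone; split=> //; rewrite subr0 subrK.
  apply: (phom_gr (pcocycle_twist _).1 (i := i)); first by rewrite addr0.
  apply/sub_incl_gr; rewrite vE; apply: grB => //; exact: gr_diffB.
rewrite diff_cone juE addrC subrK; congr pair; apply: jK.
apply: oppr_inj; rewrite -dxE -[RHS]subr0 -(diffK (dgm_dg X) x') -linearB /=.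
by rewrite -juE jc.2 expr1 scaleN1r.
Qed.

Lemma dproj_phom e n A (B : dgMod R) (f : A -> B) i x : phom e n f ->
  dproj (dgm_dg B) i (f x) = f (dproj (dgm_dg A) (i - n) x).
Proof.
move=> fh; have lf := phom_linear fh.
move: x; apply: (gr_ind (D := dgm_dg A)) => [|x y|j x xj].
- by rewrite linear0 !(linf0 lf) linear0.
- by rewrite !(linfD lf) !linearD /= (linfD lf) => -> ->.
have fx := phom_gr fh (erefl _) xj; have [->|ij] := eqVneq i (j + n).
  by rewrite fx addrK xj.
rewrite (dproj_gr_ne fx ij) (dproj_gr_ne xj) ?(linf0 lf) //.
by apply: contra ij => /eqP <-; rewrite subrK.
Qed.

(** Up to homotopy, a morphism out of [X] is supported on the degrees [>= s]
    of [X] and therefore takes its values in an acyclic submodule of [M]. *)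
Lemma contractible_hom_orthogonal X M s n : K_projective X ->
  (forall i, i < s -> coh_zero (dgm_dg X) i) ->
  (forall i, s + n <= i -> coh_zero (dgm_dg M) i) ->
  contractible_hom n X M.
Proof.
move=> KX Xs Mn; apply: (@contractible_hom_parity _ _ false) => f fc.
have lf := phom_linear fc.1.
have [C sC HT] := lower_truncation Xs; have hT := trunc_submodule s sC.
have jc := odd_incl_pcocycle hT.
(* The inclusion of X into the cone of the truncation is homotopic to 0. The
   two components of a homotopy are a map [h2] from X to the truncation and a
   homotopy [h1] from the identity to [h2] followed by the inclusion. *)
have [h hh hE] := K_projective_contractible KX (HT hT) (cone_in_pcocycle _).
pose h1 x := (h x).1; pose h2 x := (h x).2.
have lh := phom_linear hh.
have h1E x : x = diff (dgm_dg X) (h1 x) + sub_incl (twist (dgm_dg (submodule hT)) (h2 x))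
                 + h1 (diff (dgm_dg X) x).
  by have /(congr1 fst) /= := hE x; rewrite scale1r.
have h2c : pcocycle true 0 h2.
  split; last first.
    move=> x; have /(congr1 snd) /esym/eqP := hE x.
    by rewrite /= scale1r addr_eq0 expr1 scaleN1r => /eqP.
  split=> [a x y|i x xi|i r x ri]; first by rewrite /h2 lh.
    have := phom_gr hh (erefl _) xi; rewrite [h x]surjective_pairing.
    by move=> /gr_cone[_]; rewrite subr0 -addrA.
  by rewrite /h2 (phom_act _ hh ri).
have h1h : phom true (-1) h1.
  split=> [a x y|i x xi|i r x ri]; first by rewrite /h1 lh.
    have := phom_gr hh (erefl _) xi; rewrite [h x]surjective_pairing.
    by move=> /gr_cone[+ _]; rewrite sub0r.
  by rewrite /h1 (phom_act _ hh ri).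
(* After [h2], the morphism takes values in degrees [>= s + n], which an
   acyclic submodule of M contains. *)
have [|C' sC' HK] := @acyclic_truncation M (s + n - 1).
  by move=> i si; apply: Mn; lia.
have hK := trunc_submodule (s + n - 1) sC'.
have gc := pcocycle_comp (pcocycle_comp h2c jc) fc.
have [|g' g'c g'E] := pcocycle_factor hK gc.
  move=> x; have f0 i : i <= s + n - 1 ->
      dproj (dgm_dg M) i (f (sub_incl (twist (dgm_dg (submodule hT)) (h2 x)))) = 0.
    move=> im; rewrite (dproj_phom _ _ fc.1).
    have [z _] := sub_incl_in (twist (dgm_dg (submodule hT)) (h2 x)).
    by rewrite z ?(linf0 lf) //; lia.
  split=> [i im|]; rewrite /= f0 //; last exact: sC'.1.
  exact: ltW.
have [h3 h3h h3E] := K_projective_contractible KX (HK hK) g'c.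
have h3h' := phom_comp h3h (sub_incl_pcocycle hK).1.
exists (fun x => f (h1 x) + sub_incl (h3 x)).
  have fh1 := phom_comp h1h fc.1.
  split=> [a x y|i x xi|i r x ri].
  - have /= -> := phom_linear h3h' a x y.
    by rewrite (phom_linear h1h) lf scalerDr addrACA.
  - apply: (@grD _ _ _ _ (f (h1 x)) (sub_incl (h3 x))).
      by apply: (phom_gr fh1 _ xi); ring.
    by apply: (phom_gr h3h' _ xi); ring.
  - have := phom_act x fh1 ri; have /= -> := phom_act x h3h' ri.
    by rewrite /= => ->; rewrite -scalerDr actDr.
move=> x; rewrite scale1r linearD /= {1}[x]h1E !(linfD lf).
rewrite fc.2 !scale1r -[f (sub_incl _)](g'E x) h3E scale1r.
rewrite (linfD (phom_linear (sub_incl_pcocycle hK).1)) sub_incl_diff.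
rewrite -!addrA [LHS]addrA; congr (_ + _).
by rewrite addrC.
Qed.

End Truncation.

(** * Generators of the cohomology *)

Section Spanning.
Variables (k : fieldType) (V : lmodType k) (D : dgStruct V) (i : int).

(** [z] is a linear combination of [s] up to coboundaries. *)
Fixpoint spanned (s : seq V) (z : V) : Prop :=
  if s is x :: s' then exists c : k, spanned s' (z - c *: x)
  else cobounds D i z.

Definition coh_generated (s : seq V) : Prop :=
  (forall x, x \in s -> cocycles D i x) /\
  (forall z, cocycles D i z -> spanned s z).

Lemma spannedB s z b : spanned s z -> cobounds D i b -> spanned s (z - b).
Proof.
elim: s z => [|x s IHs] z /=; first exact: coboundsB.
by move=> [c zc] /(IHs _ zc) ?; exists c; rewrite addrAC.
Qed.

Lemma coh_generated_behead x s :
  cobounds D i x -> coh_generated (x :: s) -> coh_generated s.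
Proof.
move=> xB [sZ sE]; split=> [y ys|z zZ]; first by apply: sZ; rewrite inE ys orbT.
have [c /spannedB zc] := sE z zZ.
by have := zc _ (coboundsN (coboundsZ c xB)); rewrite opprK subrK.
Qed.

Lemma coh_generated_nil : coh_generated [::] <-> coh_zero D i.
Proof. by split=> [[_ H]|H]; [apply: H | split]. Qed.

Lemma spanned_sum (I : Type) (e : I -> V) (c : I -> k) (s : seq I) z :
  cobounds D i (z - \sum_(l <- s) c l *: e l) -> spanned (map e s) z.
Proof.
elim: s z => [|l s IHs] z; first by rewrite big_nil subr0.
by rewrite big_cons opprD addrA => /IHs ?; exists (c l).
Qed.

Lemma coh_dim_generated : (coh_dim D i < +oo)%E -> exists s, coh_generated s.
Proof.
rewrite /coh_dim /subquo_dim; case: xgetP => [d _ [n [e [[eZ _ esp] _]]] _|//].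
exists [seq e l | l <- enum 'I_n]; split=> [x /mapP[l _ ->]|z zZ]; first exact: eZ.
by have [c zc] := esp z zZ; apply: (spanned_sum (c := c)); rewrite big_enum.
Qed.

End Spanning.

Lemma spanned_map (k : fieldType) (V W : lmodType k) (D : dgStruct V)
    (D' : dgStruct W) (i : int) (f : V -> W) (s : seq V) z :
  linear f -> (forall x, cobounds D i x -> cobounds D' i (f x)) ->
  spanned D i s z -> spanned D' i (map f s) (f z).
Proof.
move=> lf fB; elim: s z => [|x s IHs] z /=; first exact: fB.
by move=> [c /IHs zc]; exists c; rewrite -(linfZ lf) -(linfB lf).
Qed.

Section RegularModule.
Variables (k : fieldType) (R : dgAlg k).

Lemma diff_one : diff (dga_dg R) 1 = 0.
Proof.
have := dga_leibniz 1 (dga_one R); rewrite !(mulr1, mul1r) scale1r.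
by move/eqP; rewrite -subr_eq0 opprD addNKr oppr_eq0 => /eqP.
Qed.

Section Evaluation.
Variables (A : dgMod R) (n : int) (a : A).
Hypothesis an : gr (dgm_dg A) n a.

Lemma phom_act_reg : phom false n (fun r : dgm_reg R => act r a).
Proof.
split=> [c r s|i r ri|i r s ri]; first exact: act_linearl.
  exact: act_deg.
by rewrite scale1r actA.
Qed.

(** The map from R given by a coboundary [d a] is homotopic to 0, the
    homotopy being the map given by [a]. *)
Lemma act_reg_homotopy r : act (twist (dga_dg R) r) (diff (dgm_dg A) a) =
  diff (dgm_dg A) (act r a) - act (diff (dga_dg R) r) a.
Proof.
have lt := twist_linear (dga_dg R).
move: r; apply: (gr_ind (D := dga_dg R)) => [|r s|i r ri].
- by rewrite !(linf0 lt) linear0 !act0l linear0 subrr.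
- rewrite (linfD lt) linearD !actDl linearD /= => -> ->.
  by rewrite opprD addrACA.
- by rewrite (twist_gr ri) (act_leibniz _ ri) addrC addKr actZl.
Qed.

Hypothesis da : diff (dgm_dg A) a = 0.

Lemma pcocycle_act_reg : pcocycle false n (fun r : dgm_reg R => act r a).
Proof.
split=> [|r]; first exact: phom_act_reg.
have := act_reg_homotopy r; rewrite da act0r scale1r => /esym/eqP.
by rewrite subr_eq0 => /eqP.
Qed.

Lemma pcocycle_act_twist :
  pcocycle true n (fun r : dgm_reg R => act (twist (dga_dg R) r) a).
Proof.
by have := pcocycle_comp (pcocycle_twist (dgm_reg R)) pcocycle_act_reg;
  rewrite add0r.
Qed.

End Evaluation.

(** A morphism out of R is determined by the image of 1, which is a coboundary
    when the target is acyclic. *)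
Lemma reg_K_projective : K_projective (dgm_reg R).
Proof.
move=> N aN n; apply/contractible_homP.
apply: (@contractible_hom_parity _ _ true) => f fc.
have f1 : gr (dgm_dg N) n (f 1).
  by apply: (phom_gr fc.1 _ (dga_one R)); rewrite add0r.
have [|m mi mE] := aN n (f 1).
  split=> //; rewrite fc.2 /= diff_one (linf0 (phom_linear fc.1)).
  by rewrite scaler0.
exists (fun r : dgm_reg R => act r m); first exact: phom_act_reg.
move=> r; rewrite expr1 scaleN1r -act_reg_homotopy mE.
have lt := twist_linear (dga_dg R); have lf := phom_linear fc.1.
move: r; apply: (gr_ind (D := dga_dg R)) => [|r s|i r ri].
- by rewrite (linf0 lf) (linf0 lt) act0l.
- by rewrite (linfD lf) (linfD lt) actDl => -> ->.
rewrite (twist_gr ri) actZl -[ksign k i]/(psign k true i) -(phom_act _ fc.1 ri).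
by rewrite /= mulr1.
Qed.

End RegularModule.

(** * Resolutions of the residue field *)

Section ResidueResolution.
Variables (k : fieldType) (R : dgAlg k) (scR : simply_connected R).
Variable P : K_projective_resolution (residue scR).
Implicit Types (Q M : dgMod R).

Let pi : P -> k^o := @res_map _ _ _ P.

Let pi_linear : linear pi.
Proof. by have [[]] := qi_morph (res_quasi_iso P). Qed.

Let pi_diff x : pi (diff (dgm_dg P) x) = 0.
Proof.
have [_ /(_ x)] := qi_morph (res_quasi_iso P).
rewrite /dghom_diff ksign_parity scale1r /= sub0r => /eqP.
by rewrite oppr_eq0 => /eqP.
Qed.

Let residue_cobounds i x : cobounds (dgm_dg (residue scR)) i x <-> x = 0.
Proof. by split=> [[y _ <-]|->]; last exact: cobounds0. Qed.

Lemma resolution_coh_zero i : i != 0 -> coh_zero (dgm_dg P) i.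
Proof.
move=> i0 x [xi dx]; apply: (qi_inj (res_quasi_iso P)) => //.
apply/residue_cobounds; have [[_ + _] _] := qi_morph (res_quasi_iso P).
by move=> /(_ _ _ xi); rewrite addr0 /gr /= (negbTE i0) => <-.
Qed.

(** Take for [p0] a cocycle over 1; the map P -> k vanishes on coboundaries and
    separates the cohomology classes. *)
Lemma resolution_generator : exists p0 : P,
  [/\ cocycles (dgm_dg P) 0 p0,
      forall c, cobounds (dgm_dg P) 0 (c *: p0) -> c = 0 &
      forall i x, cocycles (dgm_dg P) i x ->
        exists c, cobounds (dgm_dg P) i (x - c *: p0) /\ (i != 0 -> c = 0)].
Proof.
have [|p0 p0Z /residue_cobounds/eqP] := qi_surj (res_quasi_iso P) (j := 0) (y := 1).
  by split.
rewrite subr_eq0 => /eqP p01'; have p01 : pi p0 = 1 by [].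
exists p0; split=> // [c [y _ yE]|i x xZ].
  by have := pi_diff y; rewrite yE (linfZ pi_linear) p01 /GRing.scale /= mulr1.
have [i0|i0] := eqVneq i 0; last first.
  by exists 0; split=> //; rewrite scale0r subr0; apply: resolution_coh_zero.
exists (pi x); split=> //; rewrite i0 in xZ *.
apply: (qi_inj (res_quasi_iso P)).
  by rewrite -scaleNr addrC; apply: cocyclesP.
apply/residue_cobounds; rewrite -/pi (linfB pi_linear) (linfZ pi_linear).
by rewrite p01 /GRing.scale /= mulr1 subrr.
Qed.

Section Generator.
Variable p0 : P.
Hypothesis p0Z : cocycles (dgm_dg P) 0 p0.
Hypothesis p0_inj : forall c, cobounds (dgm_dg P) 0 (c *: p0) -> c = 0.
Hypothesis p0_gen : forall i x, cocycles (dgm_dg P) i x ->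
  exists c, cobounds (dgm_dg P) i (x - c *: p0) /\ (i != 0 -> c = 0).

Let ec := pcocycle_act_twist p0Z.1 p0Z.2.

(** The cone of the map R -> P given by [p0], that is, up to a shift and
    quasi-isomorphism, the augmentation ideal of R. *)
Definition orbit_cone : dgMod R := cone ec.
Let X := orbit_cone.
Let inX (p : P) : X := (p, 0).

Lemma orbit_cone_K_projective : K_projective X.
Proof.
apply: cone_K_projective; [exact: reg_K_projective | exact: res_K_projective].
Qed.

(** Subtracting the boundary of a primitive of [r] leaves a cocycle of P, which
    is a coboundary outside degree 0. *)
Lemma orbit_cone_cobounds i p r : i != 0 -> cocycles (dgm_dg X) i (p, r) ->
  cobounds (dga_dg R) (i + 1) r -> cobounds (dgm_dg X) i (p, r).
Proof.
move=> i0 [pr dpr] [t ti tE]; rewrite addrK in ti.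
move: pr => /gr_cone[pi' _].
have lt := phom_linear ec.1.
have zZ : cocycles (dgm_dg P) i (p - act (twist (dga_dg R) t) p0).
  split; first by apply: grB => //; apply: (phom_gr ec.1 _ ti); rewrite addr0.
  move: dpr => /(congr1 fst) /= dp; rewrite linearB /= ec.2 expr1 scaleN1r.
  by rewrite opprK /= tE.
have [v vi vE] := resolution_coh_zero i0 zZ.
exists (v, t); first by apply/gr_cone; rewrite subrK subr0.
by rewrite diff_cone vE subrK tE.
Qed.

(** In degree 0 the cone kills the class of [p0], and in degree -1 nothing is
    created since no nonzero multiple of [p0] is a coboundary; R^1 = 0
    excludes further classes in degree 0. *)
Lemma orbit_cone_coh_zero i : i <= 0 -> coh_zero (dgm_dg X) i.
Proof.
move=> i0 [p r] xZ; have [/gr_cone[pi' +] dx] := xZ; rewrite subr0 => ri.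
have dp : diff (dgm_dg P) p + act (twist (dga_dg R) r) p0 = 0.
  exact: (congr1 fst dx).
have [i00|in0] := eqVneq i 0.
  move: ri xZ dp; rewrite i00 add0r => /(sc_one scR) -> _.
  rewrite (linf0 (twist_linear _)) act0l addr0 => dp.
  rewrite i00 in pi'; have [c [[v vi vE] _]] := p0_gen (conj pi' dp).
  exists (v, c%:A).
    by apply/gr_cone; split=> //; rewrite subr0 subrK; apply: grZ; apply: dga_one.
  rewrite diff_cone vE (linfZ (twist_linear _)) (twist_gr (dga_one R)).
  rewrite scale1r actZl act1 subrK; congr pair.
  by rewrite linearZ /= diff_one scaler0.
suff r0 : r = 0 by apply: orbit_cone_cobounds => //; rewrite r0; apply: cobounds0.
have [i1|i1] := eqVneq i (-1); last first.
  by apply: (sc_neg scR _ ri); lia.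
rewrite i1 addNr in ri pi'; have [c rE] := sc_zero scR ri.
suff c0 : c = 0 by rewrite rE c0 scale0r.
apply: p0_inj; exists (- p); first by rewrite sub0r; apply: grN.
move: dp; rewrite rE (linfZ (twist_linear _)) (twist_gr (dga_one R)).
rewrite scale1r actZl act1 => /eqP; rewrite addrC addr_eq0 => /eqP ->.
by rewrite linearN.
Qed.

Lemma orbit_cone_coh_zero_pos i : i != 0 ->
  coh_zero (dga_dg R) (i + 1) -> coh_zero (dgm_dg X) i.
Proof.
move=> i0 Ri [p r] xZ; apply: orbit_cone_cobounds => //; apply: Ri.
by have [/gr_cone[_ +] [_ dr]] := xZ; rewrite subr0.
Qed.

(** A cocycle [r] of R of degree [i + 1] is the second component of a cocycle
    of the cone, because its image in P is a cocycle of nonzero degree. *)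
Lemma orbit_cone_generated i s : coh_generated (dga_dg R) (i + 1) s ->
  exists s', coh_generated (dgm_dg X) i s'.
Proof.
have [i0 _|i0] := leP i 0.
  by exists [::]; apply/coh_generated_nil; apply: orbit_cone_coh_zero.
have i00 : i != 0 by rewrite gt_eqF.
have i10 : i + 1 != 0 by apply/eqP; lia.
move=> [sZ sE].
have [s' [s's s'Z]] : exists s' : seq X, map snd s' = s /\
    forall x, x \in s' -> cocycles (dgm_dg X) i x.
  elim: s sZ {sE} => [|r s IHs] sZ; first by exists [::].
  have [|s' [s's s'Z]] := IHs.
    by move=> x xs; apply: sZ; rewrite inE xs orbT.
  have [ri dr] := sZ r (mem_head _ _).
  have rZ : cocycles (dgm_dg P) (i + 1) (act (twist (dga_dg R) r) p0).
    split; first by apply: (phom_gr ec.1 _ ri); rewrite addr0.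
    by rewrite ec.2 /= dr (linf0 (phom_linear ec.1)) scaler0.
  have [p pi' pE] := resolution_coh_zero i10 rZ; rewrite addrK in pi'.
  exists ((- p, r) :: s'); rewrite /= s's; split=> // x; rewrite inE.
  case/orP=> [/eqP->|]; last exact: s'Z.
  split; first by apply/(gr_cone ec); rewrite subr0; split=> //; apply: grN.
  by rewrite (diff_cone ec) linearN /= pE addNr dr.
exists s'; split=> // -[p r] xZ.
have : spanned (dga_dg R) (i + 1) s r.
  by apply: sE; have [/gr_cone[_ +] [_ dr]] := xZ; rewrite subr0.
elim: s' s {sZ sE} s's s'Z p r xZ => [|[p' r'] s' IHs] [|r'' s] //=.
  by move=> _ _ p r xZ; apply: orbit_cone_cobounds.
move=> [-> s's] s'Z p r xZ [c rc]; exists c.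
apply: (IHs s s's _ (p - c *: p') (r - c *: r'')) => //.
  by move=> x xs; apply: s'Z; rewrite inE xs orbT.
have := cocyclesP (- c) (s'Z _ (mem_head _ _)) xZ.
by congr cocycles; apply: (congr2 pair); rewrite /= scaleNr addrC.
Qed.

(** The obstruction to extending the map R -> Q given by [z] along the map
    R -> P given by [p0] is the homotopy class of a map of degree [b + 1] from
    the cone to [Q]. It vanishes by orthogonality, the cohomology of the cone
    being in positive degrees. *)
Lemma generator_lift Q (b : int) (z : Q) : cocycles (dgm_dg Q) b z ->
  (forall i, b < i -> coh_zero (dgm_dg Q) i) ->
  exists2 f : P -> Q, pcocycle true b f & cobounds (dgm_dg Q) b (z - f p0).
Proof.
move=> [zb dz] Qb; have gc := pcocycle_act_reg zb dz.
pose g (x : X) : Q := act x.2 z.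
have gXc : pcocycle false (b + 1) g.
  split; last by move=> [p r]; rewrite gc.2.
  split=> [a x y|i [p r] /gr_cone[_ ri]|i r x ri]; first exact: act_linearl.
    by apply: (phom_gr gc.1 _ ri); ring.
  by rewrite scale1r actA.
have [h hh hE] : pcobound false (b + 1) g.
  apply: (contractible_hom_orthogonal (s := 1) scR) gXc.
  - exact: orbit_cone_K_projective.
  - by move=> i i1; apply: orbit_cone_coh_zero; lia.
  - by move=> i bi; apply: Qb; lia.
have inc := cone_in_pcocycle ec; have lh := phom_linear hh.
exists (h \o inX).
  have hin := phom_comp inc.1 hh.
  split; first by move: hin; rewrite add0r addrK.
  move=> p; have := hE (p, 0).
  rewrite scale1r diff_cone (linf0 (phom_linear ec.1)) addr0 linear0.
  rewrite /g act0l => /esym/eqP; rewrite addr_eq0 expr1 scaleN1r => /eqP.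
  exact.
have := hE (0, 1); rewrite diff_cone linear0 add0r (twist_gr (dga_one R)).
rewrite !scale1r act1 /g /= act1 diff_one => ->; rewrite addrK.
exists (h (0, 1)) => //; apply: (phom_gr hh (i := -1)); first by ring.
by apply/gr_cone; split; [exact: gr0 | exact: dga_one].
Qed.

Section Attachment.
Variables (Q : dgMod R) (b : int) (f : P -> Q).
Hypothesis fc : pcocycle true b f.
Hypothesis f_inj : forall c, cobounds (dgm_dg Q) b (c *: f p0) -> c = 0.

(** A cocycle of the cone has in P a cocycle as second component. It is a
    coboundary: a nonzero multiple of [p0] in its class would be mapped by [f]
    to a coboundary. *)
Lemma attach_onto i (x : cone fc) : cocycles (dgm_dg (cone fc)) i x ->
  exists2 q, cocycles (dgm_dg Q) i q & cobounds (dgm_dg (cone fc)) i (x - (q, 0)).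
Proof.
case: x => [q u] [/gr_cone[qi ui] dx]; have lf := phom_linear fc.1.
have dq : diff (dgm_dg Q) q + f u = 0 by exact: (congr1 fst dx).
have du : diff (dgm_dg P) u = 0 by exact: (congr1 snd dx).
have [c [[v vi vE] cE]] := p0_gen (conj ui du).
have c0 : c = 0.
  have [ib|ib] := eqVneq (i + 1) b; last by apply: cE; apply: contra ib => /eqP; lia.
  apply: f_inj; have -> : c *: f p0 = f u - f (diff (dgm_dg P) v).
    by rewrite vE (linfB lf) (linfZ lf) opprB addrCA subrr addr0.
  have -> : f u = - diff (dgm_dg Q) q.
    by apply/eqP; rewrite -addr_eq0 addrC dq.
  exists (f v - q); last by rewrite linearB /= fc.2 expr1 scaleN1r addrC.
  rewrite -ib addrK; apply: grB => //; apply: (phom_gr fc.1 _ vi).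
  by rewrite -ib; ring.
rewrite c0 scale0r subr0 in vE.
have dv : cobounds (dgm_dg (cone fc)) i (f v, u).
  exists (0, v); last by rewrite diff_cone linear0 add0r vE.
  by apply/gr_cone; split; [exact: gr0 | move: vi; congr gr; ring].
exists (q - f v).
  split; first by apply: grB => //; apply: (phom_gr fc.1 _ vi); ring.
  rewrite linearB /= fc.2 expr1 scaleN1r opprK vE; exact: dq.
by move: dv; congr cobounds; apply: (congr2 pair); rewrite /= ?subr0 // subKr.
Qed.

Lemma attach_cobounds i q :
  cobounds (dgm_dg Q) i q -> cobounds (dgm_dg (cone fc)) i (q, 0).
Proof.
move=> [v vi <-]; exists (v, 0); first by apply/gr_cone; split=> //; exact: gr0.
by rewrite diff_cone (linf0 (phom_linear fc.1)) addr0 linear0.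
Qed.

Lemma attach_coh_zero i :
  coh_zero (dgm_dg Q) i -> coh_zero (dgm_dg (cone fc)) i.
Proof.
move=> Qi x /attach_onto[q /Qi/attach_cobounds qB xq].
by rewrite -[x](subrK (q, 0)); apply: coboundsD.
Qed.

Lemma attach_generated i s : coh_generated (dgm_dg Q) i s ->
  coh_generated (dgm_dg (cone fc)) i [seq (x, 0) | x <- s].
Proof.
have lin := phom_linear (cone_in_pcocycle fc).1.
move=> [sZ sE]; split=> [_ /mapP[x /sZ[xi dx] ->]|x /attach_onto[q /sE qs xq]].
  split; first by apply/gr_cone; split=> //; exact: gr0.
  by rewrite diff_cone (linf0 (phom_linear fc.1)) addr0 linear0 dx.
have qs' := spanned_map lin (@attach_cobounds i) qs.
have := spannedB qs' (coboundsN xq).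
by rewrite opprK addrC subrK.
Qed.

(** In the cone, [f p0] is the boundary of [p0]. *)
Lemma attach_kills x :
  cobounds (dgm_dg Q) b (x - f p0) -> cobounds (dgm_dg (cone fc)) b (x, 0).
Proof.
move=> /attach_cobounds xB; rewrite -[(x, 0)](subrK (f p0, 0)).
apply: coboundsD.
  by move: xB; congr cobounds; apply: (congr2 pair); rewrite /= ?subr0.
exists (0, p0); last by rewrite diff_cone linear0 add0r p0Z.2.
apply/gr_cone; split; [exact: gr0 | move: p0Z.1; congr gr; ring].
Qed.

End Attachment.

(** The cohomology of [Q] is killed from the top, one class at a time, by
    cones of maps from shifts of P; the morphism [F] extends over each cone by
    the hypothesis on maps from P to [M]. Once [Q] is acyclic, [g] itself is
    homotopic to 0. *)
Lemma pcobound_through_finite M (j : int) (b : nat) :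
  (forall l : int, j + 1 <= l <= j + b%:Z -> contractible_hom l P M) ->
  forall Q (g : P -> Q) (F : Q -> M),
  pcocycle false 0 g -> pcocycle false j F ->
  (forall i : int, i <= 0 -> coh_zero (dgm_dg Q) i) ->
  (forall i : int, b%:Z < i -> coh_zero (dgm_dg Q) i) ->
  (forall i, exists s, coh_generated (dgm_dg Q) i s) ->
  pcobound false j (F \o g).
Proof.
elim: b => [|b IHb] PM Q g F gc Fc Q0 Qb Qg.
  have aQ : acyclic (dgm_dg Q).
    by move=> i; have [i0|i0] := leP i 0; [apply: Q0 | apply: Qb].
  have := pcobound_compl
    (K_projective_contractible (@res_K_projective _ _ _ P) aQ gc) Fc.
  by rewrite add0r.
have [s] := Qg b.+1; move sn: (size s) => n.
elim: n Q g F gc Fc Q0 Qb Qg s sn => [|n IHn] Q g F gc Fc Q0 Qb Qg [] //=.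
  move=> _ sQ.
  apply: IHb gc Fc Q0 _ Qg => [l lj|i bi]; first by apply: PM; lia.
  have [->|ib] := eqVneq i b.+1; first exact/coh_generated_nil.
  by apply: Qb; lia.
move=> x s [sn] sQ; have [xB|xB] := pselect (cobounds (dgm_dg Q) b.+1 x).
  exact: IHn gc Fc Q0 Qb Qg _ sn (coh_generated_behead xB sQ).
have [f fc fx] := generator_lift (sQ.1 x (mem_head _ _)) Qb.
have f_inj c : cobounds (dgm_dg Q) b.+1 (c *: f p0) -> c = 0.
  move=> cB; apply: contra_notP xB => /eqP c0.
  rewrite -[x](subrK (f p0)); apply: coboundsD => //.
  by rewrite -[f p0]scale1r -(mulVf c0) -scalerA; apply: coboundsZ.
have [|G Gc GE] := cone_extension fc Fc.
  have ct : contractible_hom (b.+1%:Z + j) P M by apply: PM; lia.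
  by apply: ct; apply: pcocycle_comp fc Fc.
have -> : F \o g = G \o ((fun q => (q, 0)) \o g).
  by apply: funext => p /=; rewrite GE.
apply: IHn Gc _ _ _ _ _ _; first exact: pcocycle_comp gc (cone_in_pcocycle fc).
- by move=> i /Q0; apply: attach_coh_zero.
- by move=> i /Qb; apply: attach_coh_zero.
- by move=> i; have [t /(attach_generated fc f_inj)] := Qg i; eexists; eassumption.
- by rewrite -sn; apply: (size_map (fun q => (q, 0) : cone fc)).
- exact: coh_generated_behead (attach_kills _ fx) (attach_generated fc f_inj sQ).
Qed.

Hypothesis fgR : forall i, exists s, coh_generated (dga_dg R) i s.

(** As the image of [p0] is a coboundary, the composite with R -> P is
    homotopic to 0, and the morphism extends to the cone. *)
Lemma contractible_hom_gap_generator M (j : int) (d : nat) :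
  (forall i : int, d%:Z < i -> coh_zero (dga_dg R) i) ->
  coh_zero (dgm_dg M) j ->
  (forall l : int, j + 1 <= l <= j + d%:Z -> contractible_hom l P M) ->
  contractible_hom j P M.
Proof.
move=> Rd Mj PM; apply: (@contractible_hom_parity _ _ false) => F Fc.
have lF := phom_linear Fc.1.
have [|m mj mE] := Mj (F p0).
  split; first by apply: (phom_gr Fc.1 _ p0Z.1); rewrite add0r.
  by rewrite Fc.2 p0Z.2 (linf0 lF) scaler0.
have [|G Gc GE] := cone_extension ec Fc.
  exists (fun r : dgm_reg R => act r m).
    by rewrite add0r; apply: phom_act_reg.
  move=> r; rewrite expr1 scaleN1r -act_reg_homotopy mE /=.
  move: (twist _ r) => {}r; move: r.
  apply: (gr_ind (D := dga_dg R)) => [|r s|i r ri].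
  - by rewrite !act0l (linf0 lF).
  - by rewrite !actDl (linfD lF) => -> ->.
  - by rewrite (phom_act _ Fc.1 ri) scale1r.
have -> : F = G \o inX by apply: funext => p /=; rewrite GE.
apply: (pcobound_through_finite (b := d)) Gc _ _ _ => //.
- exact: cone_in_pcocycle.
- exact: orbit_cone_coh_zero.
- by move=> i di; apply: orbit_cone_coh_zero_pos; [lia | apply: Rd; lia].
- by move=> i; have [s] := fgR (i + 1); apply: orbit_cone_generated.
Qed.

End Generator.

Lemma contractible_hom_gap M (j : int) (d : nat) :
  (forall i, exists s, coh_generated (dga_dg R) i s) ->
  (forall i : int, d%:Z < i -> coh_zero (dga_dg R) i) ->
  coh_zero (dgm_dg M) j ->
  (forall l : int, j + 1 <= l <= j + d%:Z -> contractible_hom l P M) ->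
  contractible_hom j P M.
Proof.
move=> fgR Rd Mj PM; have [p0 [p0Z p0_inj p0_gen]] := resolution_generator.
exact (contractible_hom_gap_generator p0Z p0_inj p0_gen fgR Rd Mj PM).
Qed.

Lemma contractible_hom_above M (a : int) :
  (forall t : int, a <= t -> coh_zero (dgm_dg M) t) -> contractible_hom a P M.
Proof.
move=> Ma; apply: (contractible_hom_orthogonal (s := 0) scR).
- exact: res_K_projective.
- by move=> i i0; apply: resolution_coh_zero; rewrite lt_eqF.
- by move=> i; rewrite add0r; apply: Ma.
Qed.

End ResidueResolution.

(** * Dimensions and suprema *)

Lemma subquo_dim_eq0 (k : fieldType) (V : lmodType k) (Z B : set V) :
  subquo_dim Z B = 0%E <-> (Z `<=` B)%classic.
Proof.
have basis0 : (Z `<=` B)%classic -> @subquo_basis k V Z B 0 (fun=> 0).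
  move=> ZB; split=> [[]//|c _ []//|z /ZB Bz].
  by exists (fun=> 0); rewrite big_ord0 subr0.
rewrite /subquo_dim; split=> [|ZB].
  case: xgetP => [d _ [n [e [[_ _ esp] ->]]] [n0] z /esp[c]|//].
  by move: c e esp; rewrite n0 => c e _; rewrite big_ord0 subr0.
case: xgetP => [d _ [n [e [[eZ eB _] ->]]]|H]; last first.
  by case: (H 0%E); exists 0%N, (fun=> 0); split=> //; apply: basis0.
case: n e eZ eB => [//|n] e eZ eB.
have Be0 : B (\sum_i ((i == ord0)%:R : k) *: e i).
  rewrite (bigD1 ord0) //= big1 ?addr0 ?scale1r; first by apply/ZB/eZ.
  by move=> i /negbTE ->; rewrite scale0r.
by have /eqP := eB _ Be0 ord0; rewrite eqxx oner_eq0.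
Qed.

Section IntegerBounds.
Implicit Types (A : set int) (i j n : int).

Lemma int_max A j n : A j -> (forall i, A i -> i <= n) ->
  exists2 m, A m & forall i, A i -> i <= m.
Proof.
move=> Aj An; have [d] : exists d : nat, n - j <= d%:Z.
  by exists `|n - j|%N; lia.
elim: d j Aj => [|d IHd] j Aj jd.
  by exists j => // i /An; lia.
have [H|/existsNP[i /not_implyP[Ai /negP ij]]] := pselect (forall i, A i -> i <= j).
  by exists j.
by apply: IHd Ai _; lia.
Qed.

(** [supremum] has a default value on sets without a least upper bound, so one
    must be exhibited: a maximum, or +oo for an unbounded set. *)
Lemma int_supremum_ge A j : A j ->
  (j%:E <= supremum -oo [set i%:E | i in A]%classic :> \bar int)%E.
Proof.
move=> Aj; set S := [set _ | _ in _]%classic.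
have Sj : S j%:E by exists j.
rewrite /supremum ifF; last by apply/eqP => S0; rewrite S0 in Sj.
suff : exists x, supremums S x by move=> /(xgetPex (-oo)%E)[+ _]; apply.
have [[n An]|nA] := pselect (exists n, forall i, A i -> i <= n).
  have [m Am mA] := int_max Aj An; exists m%:E; split=> [_ [i Ai <-]|y]; last first.
    by apply; exists m.
  by rewrite lee_fin; apply: mA.
exists +oo%E; split=> [x _|y Sy]; first exact: leey.
case: y Sy => [r|//|] Sy; last by have := Sy _ Sj.
by case: nA; exists r => i Ai; rewrite -lee_fin; apply: Sy; exists i.
Qed.

Lemma int_infimum_le A j : A j ->
  (infimum +oo [set i%:E | i in A]%classic <= j%:E :> \bar int)%E.
Proof.
move=> Aj; set S := [set _ | _ in _]%classic.
have Sj : S j%:E by exists j.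
rewrite /infimum ifF; last by apply/eqP => S0; rewrite S0 in Sj.
suff : exists x, infimums S x by move=> /(xgetPex (+oo)%E)[+ _]; apply.
have [[n An]|nA] := pselect (exists n, forall i, A i -> n <= i).
  have [||m [i Ai <-] mA] := @int_max [set - i | i in A]%classic (- j) (- n).
  - by exists j.
  - by move=> _ [i Ai <-]; rewrite lerN2; apply: An.
  exists i%:E; split=> [_ [l Al <-]|y]; last by apply; exists i.
  by rewrite lee_fin -lerN2; apply: mA; exists l.
exists -oo%E; split=> [x _|y Sy]; first exact: leNye.
case: y Sy => [r||//] Sy; last by have := Sy _ Sj.
by case: nA; exists r => i Ai; rewrite -lee_fin; apply: Sy; exists i.
Qed.

End IntegerBounds.

Section Amplitude.
Variables (k : fieldType) (V : lmodType k) (D : dgStruct V).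

Lemma dg_sup_ge j : ~ coh_zero D j -> (j%:E <= dg_sup D)%E.
Proof. exact: int_supremum_ge. Qed.

Lemma dg_inf_le j : ~ coh_zero D j -> (dg_inf D <= j%:E)%E.
Proof. exact: int_infimum_le. Qed.

Lemma dg_amp_ge i j : ~ coh_zero D i -> ~ coh_zero D j ->
  ((j - i)%:E <= dg_amp D)%E.
Proof.
move=> /dg_inf_le Di /dg_sup_ge Dj; rewrite /dg_amp EFinB.
exact: leeB.
Qed.

End Amplitude.

(** * Gaps in the Bass numbers *)

Section Gaps.
Variables (k : fieldType) (R : dgAlg k) (scR : simply_connected R).
Hypothesis finR : locally_finite (dga_dg R).
Variable P : K_projective_resolution (residue scR).

Lemma bass_eq0 M j : bass P M j = 0%E <-> contractible_hom j P M.
Proof.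
by split=> [/subquo_dim_eq0/contractible_homP|/contractible_homP/subquo_dim_eq0].
Qed.

Lemma dg_sup_ge0 : (0 <= dg_sup (dga_dg R))%E.
Proof.
apply: dg_sup_ge => R0.
have [|x xi x1] := R0 1; first by split; [exact: dga_one | exact: diff_one].
have x0 : x = 0 by apply: (sc_neg scR _ xi).
by move/eqP: x1; rewrite x0 linear0 eq_sym oner_eq0.
Qed.

(** Here [i] is the lower end of the gap, and [j] is at or above its upper
    end. *)
Lemma gap_cohomology M (g : int) : (dg_sup (dga_dg R) <= g%:E)%E ->
  has_gap (bass P M) g ->
  exists i j, [/\ ~ coh_zero (dgm_dg M) i, ~ coh_zero (dgm_dg M) j & g < j - i].
Proof.
move=> Rg [j [muj mugap muend]].
have g0 : 0 <= g by have := le_trans dg_sup_ge0 Rg; rewrite lee_fin.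
have Mj : ~ coh_zero (dgm_dg M) j.
  move=> Mj; apply/muj/bass_eq0; apply: (contractible_hom_gap (d := `|g|%N)) Mj _.
  - by move=> i; apply: coh_dim_generated; apply: finR.
  - move=> i gi; apply: contrapT => /dg_sup_ge Ri.
    by have := le_trans Ri Rg; rewrite lee_fin; lia.
  - by move=> l jl; apply/bass_eq0/mugap; lia.
have [t [ta Mt]] : exists t, j + g + 1 <= t /\ ~ coh_zero (dgm_dg M) t.
  apply: contrapT => nt; apply/muend/bass_eq0/contractible_hom_above => t ta.
  by apply: contrapT => Mt; apply: nt; exists t.
by exists j, t; split=> //; lia.
Qed.

End Gaps.

Unset Implicit Arguments.

Theorem mainTheorem7 (k : fieldType) (R : dgAlg k) (scR : simply_connected R)
    (finR : locally_finite (dga_dg R))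
    (P : K_projective_resolution (residue scR))
    (supR : (dg_sup (dga_dg R) < +oo)%E) :
  (forall M : dgMod R,
     locally_finite (dgm_dg M) ->
     coh_bounded_above (dgm_dg M) ->
     (dg_amp (dgm_dg M) <= dg_sup (dga_dg R))%E ->
     forall g : int, (dg_sup (dga_dg R) <= g%:E)%E -> ~ has_gap (bass P M) g)
  /\
  (forall g : int, (dg_sup (dga_dg R) <= g%:E)%E ->
     ~ has_gap (bass P (dgm_reg R)) g).
Proof.
split=> [M _ _ ampM g Rg|g Rg] /(gap_cohomology finR Rg)[i [j [Mi Mj gij]]].
  have := le_trans (le_trans (dg_amp_ge Mi Mj) ampM) Rg.
  by rewrite lee_fin leNgt gij.
have i0 : 0 <= i.
  rewrite leNgt; apply/negP => i0; apply: Mi => x [xi _].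
  by rewrite (sc_neg scR i0 xi); apply: cobounds0.
have := le_trans (dg_sup_ge Mj) Rg; rewrite lee_fin; lia.
Qed.
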